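(* There exists $d_0$ such that for every $d\ge d_0$ and every convex body $K\subset\mathbb{R}^d$ with $o\in\mathrm{int}(K)$, \[\kappa'(K,o)\ge h'(K)\ge\frac{1}{4d^2}\left(\frac{2}{\sqrt3}\right)^d.\]
   Context: A convex body in $\mathbb{R}^d$ is a compact convex set with non-empty interior. For a convex body $K$ with $o\in\mathrm{int}(K)$, the (possibly asymmetric) norm is $\|x\|_K=\inf\{\lambda>0: x\in\lambda K\}$. $h'(K)$ is the maximum number of points $p_1,\dots,p_m$ on the boundary $\mathrm{bd}\,K$ such that $\|p_i-p_j\|_K>1$ for all distinct $i,j$. A strict Minkowski arrangement of $K$ with respect to $o$ is a family $\{v_i+\lambda_iK\}$ of positive homothets ($\lambda_i>0$, $v_i\in\mathbb{R}^d$) with $v_i\notin v_j+\lambda_jK$ for all distinct $i,j$; $\kappa'(K,o)$ is the largest size of a pairwise intersecting strict Minkowski arrangement of $K$ with respect to $o$. *)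

(* Defs.v *)
From HB Require Import structures.
From mathcomp Require Import all_boot all_order all_algebra.
From mathcomp Require Import all_classical all_reals all_analysis.
From mathcomp Require Import Rstruct Rstruct_topology.
Set Implicit Arguments. Unset Strict Implicit. Unset Printing Implicit Defensive.
Import Order.TTheory GRing.Theory Num.Theory.
Local Open Scope classical_set_scope.
Local Open Scope ring_scope.

Notation RR := Rdefinitions.R.
Notation vec d := 'rV[RR]_d.

Definition convexR (d : nat) (K : set (vec d)) : Prop :=
  forall x y (t : RR), K x -> K y -> 0 <= t -> t <= 1 -> K (t *: x + (1 - t) *: y).

Definition convex_body (d : nat) (K : set (vec d)) : Prop :=
  compact K /\ convexR K /\ (interior K !=set0).

Definition homothet (d : nat) (v : vec d) (l : RR) (K : set (vec d)) : set (vec d) :=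
  [set v + l *: y | y in K].

Definition gauge (d : nat) (K : set (vec d)) (x : vec d) : RR :=
  inf [set l : RR | 0 < l /\ homothet 0 l K x].

Definition bdK (d : nat) (K : set (vec d)) : set (vec d) := closure K `\` interior K.

Definition h_config (d : nat) (K : set (vec d)) (m : nat) : Prop :=
  exists p : 'I_m -> vec d, (forall i, bdK K (p i)) /\
    (forall i j, i != j -> 1 < gauge K (p i - p j)).

Definition h' (d : nat) (K : set (vec d)) : \bar RR :=
  ereal_sup [set (m%:R : RR)%:E | m in h_config K].

(* pairwise intersecting strict Minkowski arrangement of m homothets of K
   (w.r.t. the origin o = 0) *)
Definition kappa_config (d : nat) (K : set (vec d)) (m : nat) : Prop :=
  exists (v : 'I_m -> vec d) (l : 'I_m -> RR),
    (forall i, 0 < l i) /\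
    (forall i j, i != j -> ~ homothet (v j) (l j) K (v i)) /\
    (forall i j, homothet (v i) (l i) K `&` homothet (v j) (l j) K !=set0).

Definition kappa' (d : nat) (K : set (vec d)) : \bar RR :=
  ereal_sup [set (m%:R : RR)%:E | m in kappa_config K].

(* Main.v *)
Require Import Defs.
From HB Require Import structures.
From mathcomp Require Import all_boot all_order all_algebra.
From mathcomp Require Import all_classical all_reals all_analysis.
From mathcomp Require Import Rstruct Rstruct_topology.
From mathcomp Require Import measurable_realfun ring lra zify.
Set Implicit Arguments. Unset Strict Implicit. Unset Printing Implicit Defensive.
Import Order.TTheory GRing.Theory Num.Theory.
Import numFieldNormedType.Exports.
Local Open Scope ring_scope.

(* For independent uniform points [x], [y] of a body [K], the probability that
   [x - y] lies in [K] is at most [(sqrt 3 / 2) ^ d] (Arias-de-Reyna, Ball and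
   Villa).  This follows from the sharp Young inequality
     [int int (f x * g y * h (x - y))^(2/3) <= sqrt 3 / 2 * (int f * int g * int h)^(2/3)],
   whose constant tensorizes.  On the line it is proved by Barthe's transport
   argument: if [U] and [V] push [f] and [g] to Gaussians, the arithmetic-geometric
   mean inequality bounds the integrand by two functions of explicit integral.
   In dimension [d], volumes are replaced by numbers of lattice points in large
   dilates of [K]: applied to piecewise linear functions, Young's inequality yields a
   kernel on the integers with the same constant, which is then tensorized.
   If [p_x = x / |x|] and [q > 1], then for [x], [y] in a shell [s < |.| <= q s] with
   [p_x - p_y] in [K], the difference [q x - y] lies in a slightly larger dilate of
   [K]; hence few pairs of lattice points of the shell have this property, and a
   large set of them has pairwise distances of projections greater than 1.
   Finally, for such points [p_i] the translates [K - p_i] all contain the origin. *)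

(** * Integration on the line *)

Section Substitution.
Local Open Scope classical_set_scope.
Context {R : realType}.
Notation mu := (@lebesgue_measure R).

Lemma bigcup_itvN : \bigcup_n `[- n%:R, n%:R]%classic = [set: R].
Proof.
rewrite -subTset => x _.
exists (Num.bound `|x|) => //=; rewrite in_itv/= -ler_norml ltW//.
exact: archi_boundP.
Qed.

Lemma ge0_cvgn_integral_itvN (f : R -> R) : measurable_fun setT f ->
  (forall x, 0 <= f x) ->
  (\int[mu]_(x in `[(- n%:R)%R, n%:R%R]) (f x)%:E @[n --> \oo] --> \int[mu]_x (f x)%:E)%E.
Proof.
move=> mf f0; rewrite -bigcup_itvN.
apply: ge0_nondecreasing_set_cvg_integral => //.
- move=> n m nm; apply/subsetPset/subset_itv; rewrite bnd_simp ?lerN2 ler_nat//.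
- by move=> i; apply/measurable_EFinP/measurable_funTS.
- by move=> i x _; rewrite lee_fin.
Qed.

(** An inequality only, because [F] need not be onto. On [[- n, n]] the substitution is exact and
    its image is the segment from [F (- n)] to [F n], whose integral is at most that over the line;
    then [n] tends to infinity. *)
Lemma integral_substitution_le (F F' G : R -> R) :
  {homo F : x y / x < y} -> (forall x : R, is_derive x 1 F (F' x)) ->
  continuous F' -> continuous G -> (forall x, 0 <= G x) ->
  (\int[mu]_x (G (F x) * F' x)%R%:E <= \int[mu]_x (G x)%:E)%E.
Proof.
move=> incF dF cF' cG G0.
have F'E : F^`()%classic = F' by apply/funext => x; rewrite derive1E derive_val.
have dF1 x : derivable F x 1 by case: (dF x).
have cF : continuous F.
  by move=> x; exact/differentiable_continuous/derivable1_diffP.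
have mGF : measurable_fun setT (fun x => G (F x) * F' x).
  apply: measurable_funM; last exact: continuous_measurable_fun.
  by apply: continuous_measurable_fun => x; apply: continuous_comp; [exact: cF|exact: cG].
have F'0 x : 0 <= F' x.
  rewrite -F'E; apply: (@incr_derive1_ge0 _ _ setT) => //.
  + by move=> y z _ _; exact: incF.
  + by rewrite interiorT.
have GF0 x : 0 <= G (F x) * F' x by rewrite mulr_ge0.
have cv := ge0_cvgn_integral_itvN mGF GF0.
rewrite -(cvg_lim _ cv)//; apply: lime_le; first exact: (cvgP _ cv).
apply: nearW => n.
have -> : (\int[mu]_(x in `[(- n%:R)%R, n%:R%R]) (G (F x) * F' x)%R%:E =
   \int[mu]_(x in `[F (- n%:R)%R, F n%:R%R]) (G x)%:E)%E.
  rewrite (@integration_by_substitution_increasing _ F G) ?F'E//.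
  - by rewrite (@le_trans _ _ 0) ?oppr_le0.
  - by move=> x y _ _; exact: incF.
  - by apply/cvg_ex; exists (F' (- n%:R)); apply/cvg_at_right_filter/cF'.
  - by apply/cvg_ex; exists (F' (n%:R)); apply/cvg_at_left_filter/cF'.
  - split; first by move=> x _.
    + exact/cvg_at_right_filter/cF.
    + exact/cvg_at_left_filter/cF.
  - exact: continuous_subspaceT.
apply: ge0_subset_integral => //=.
- by apply/measurable_EFinP; exact: continuous_measurable_fun.
- by move=> x _; rewrite lee_fin.
Qed.

End Substitution.

(** * Monotone transport between positive continuous densities *)

Section Transport.
Local Open Scope classical_set_scope.
Context {R : realType}.
Notation mu := (@lebesgue_measure R).

Lemma gt0_is_derive_homo (F F' : R -> R) :
  (forall x : R, is_derive x 1 F (F' x)) -> (forall x, 0 < F' x) ->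
  {homo F : x y / x < y}.
Proof.
move=> dF F'0 x y xy.
have [|z _] := @MVT R F F' x y xy.
- apply: continuous_subspaceT => z.
  by apply/differentiable_continuous/derivable1_diffP; case: (dF z).
- by move=> E; rewrite -subr_gt0 E mulr_gt0 ?subr_gt0.
Qed.

Section Cdf.
Variables (f : R -> R) (m : R).
Hypotheses (cf : continuous f) (f0 : forall x, 0 < f x).
Hypothesis intf : (\int[mu]_x (f x)%:E = m%:E)%E.

Let mf : measurable_fun setT f. Proof. exact: continuous_measurable_fun. Qed.

Let mfE D : measurable_fun D (EFin \o f).
Proof. by apply/measurable_EFinP; exact: measurable_funTS. Qed.

Let f0E x : (0 <= (f x)%:E)%E. Proof. by rewrite lee_fin ltW. Qed.

Lemma ge0_integrable_fin : mu.-integrable setT (EFin \o f).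
Proof.
apply/integrableP; split; first exact: mfE.
by under eq_integral do rewrite /= ger0_norm ?ltW//; rewrite intf ltry.
Qed.

Definition cdfun (x : R) : R := \int[mu]_(t in `]-oo, x]) f t.

Let cdfunE x : (\int[mu]_(t in `]-oo, x]) (f t)%:E = (cdfun x)%:E)%E.
Proof.
rewrite /cdfun /Rintegral fineK//; apply: integrable_fin_num => //.
exact: integrableS ge0_integrable_fin.
Qed.

Lemma is_derive_cdfun (x : R) : is_derive x 1 cdfun (f x).
Proof.
have [||||d1 d2] := @continuous_FTC1 R f -oo%O x (x + 1).
- by rewrite ltrDl.
- exact: integrableS ge0_integrable_fin.
- by rewrite ltNyr.
- exact: cf.
- by split; [exact: d1|rewrite -derive1E; exact: d2].
Qed.

Lemma cdfun_homo : {homo cdfun : x y / x < y}.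
Proof. exact: gt0_is_derive_homo is_derive_cdfun f0. Qed.

Lemma continuous_cdfun : continuous cdfun.
Proof.
move=> x; apply/differentiable_continuous/derivable1_diffP.
by case: (is_derive_cdfun x).
Qed.

Lemma cdfun_gt0 x : 0 < cdfun x.
Proof.
apply: (@le_lt_trans _ _ (cdfun (x - 1))); last by rewrite cdfun_homo// gtrBl.
by rewrite -lee_fin -cdfunE; apply: integral_ge0.
Qed.

Let cdfun_le x : cdfun x <= m.
Proof.
rewrite -lee_fin -cdfunE -intf; apply: ge0_subset_integral => //.
exact: mfE.
Qed.

Lemma cdfun_lt x : cdfun x < m.
Proof. by rewrite (lt_le_trans _ (cdfun_le (x + 1)))// cdfun_homo// ltrDl. Qed.

(** The masses of [[- n, n]] tend to [m], so [cdfun n] exceeds any value below [m] and [cdfun (- n)]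
    falls below any positive value; the intermediate value theorem does the rest. *)
Lemma cdfun_surj y : 0 < y -> y < m -> exists x, cdfun x = y.
Proof.
move=> y0 ym.
have ex_n c : c < m ->
    exists n : nat, (c%:E < \int[mu]_(x in `[(- n%:R)%R, n%:R%R]) (f x)%:E)%E.
  move=> cm; apply/not_existsP => H.
  suff : m <= c by rewrite leNgt cm.
  have cv := ge0_cvgn_integral_itvN mf (fun x => ltW (f0 x)).
  rewrite -lee_fin -intf -(cvg_lim _ cv)//; apply: lime_le; first exact: (cvgP _ cv).
  by apply: nearW => n; rewrite leNgt; apply/negP/H.
have split_n (n : nat) : ((cdfun (- n%:R))%:E +
    \int[mu]_(x in `[(- n%:R)%R, n%:R%R]) (f x)%:E = (cdfun n%:R)%:E)%E.
  rewrite -!cdfunE (@itv_bndbnd_setU _ _ -oo%O (BRight (- n%:R)) (BRight n%:R))//=; last first.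
    by rewrite bnd_simp (@le_trans _ _ 0) ?oppr_le0.
  rewrite ge0_integral_setU; [|exact: measurable_itv|exact: measurable_itv|exact: mfE|by []|].
  - by congr (_ + _)%E; rewrite [RHS]integral_itv_obnd_cbnd//; exact: mfE.
  - rewrite disj_set2E; apply/eqP; rewrite -subset0 => z [] /=; rewrite !in_itv/= => z1 /andP[z2 _].
    by move: (lt_le_trans z2 z1); rewrite ltxx.
have [n1 Hn1] := ex_n _ ym.
(* Once [[- n, n]] carries more than [m - y], less than [y] is left for the lower tail. *)
have [n2 Hn2] : exists n : nat, cdfun (- n%:R) < y.
  have [|n Hn] := ex_n (m - y); first by rewrite gtrBl.
  exists n; rewrite ltNge; apply/negP => yn.
  have := cdfun_le n%:R; rewrite -lee_fin -split_n leNgt => /negP; apply.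
  apply: (@lt_le_trans _ _ (y%:E + \int[mu]_(x in `[(- n%:R)%R, n%:R%R]) (f x)%:E)%E).
    by rewrite -lteBlDl.
  by rewrite leeD2r// lee_fin.
have n1y : y < cdfun n1%:R.
  rewrite -lte_fin (lt_le_trans Hn1)// -split_n leeDr// lee_fin ltW//.
  exact: cdfun_gt0.
have leab : - n2%:R <= n1%:R :> R by rewrite (@le_trans _ _ 0) ?oppr_le0.
have [||x _ <-] := @IVT R cdfun (- n2%:R) n1%:R y leab.
- exact/continuous_subspaceT/continuous_cdfun.
- by rewrite ge_min le_max (ltW Hn2) (ltW n1y) orbT.
- by exists x.
Qed.

End Cdf.

(** [U] is the distribution function of [f] followed by the inverse of that of [g]. Differentiating
    [cdfun g (U x) = cdfun f x] gives the equation [U' = f / (g o U)]. *)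
Lemma monotone_transport (f g : R -> R) (m : R) :
  continuous f -> (forall x, 0 < f x) -> (\int[mu]_x (f x)%:E = m%:E)%E ->
  continuous g -> (forall x, 0 < g x) -> (\int[mu]_x (g x)%:E = m%:E)%E ->
  exists U : R -> R, forall x : R, is_derive x 1 U (f x / g (U x)).
Proof.
move=> cf f0 If cg g0 Ig.
(* [Q] inverts [cdfun g] on [(0, m)] and is arbitrary elsewhere; distribution functions take values
   in [(0, m)] only. *)
have /choice[Q QE] : forall y, exists x, 0 < y -> y < m -> cdfun g x = y.
  move=> y; have [y0|] := boolP (0 < y); last by exists 0.
  have [ym|] := boolP (y < m); last by exists 0.
  by have [x xy] := cdfun_surj cg g0 Ig y0 ym; exists x.
have QK x : Q (cdfun g x) = x.
  have E : cdfun g (Q (cdfun g x)) = cdfun g x.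
    by rewrite QE ?(cdfun_gt0 cg g0 Ig) ?(cdfun_lt cg g0 Ig).
  apply/eqP; rewrite eq_le !leNgt.
  apply/andP; split; apply/negP => /(cdfun_homo cg g0 Ig); rewrite E ltxx//.
exists (Q \o cdfun f) => x.
have dQ (z : R) : is_derive (cdfun g z) 1 Q (g z)^-1.
  apply: (@is_derive_inverse _ (cdfun g)).
  - by near=> y; exact: QK.
  - by near=> y; exact: (continuous_cdfun cg g0 Ig).
  - exact: (is_derive_cdfun cg g0 Ig).
  - by rewrite gt_eqF.
have E : cdfun g (Q (cdfun f x)) = cdfun f x.
  by rewrite QE ?(cdfun_gt0 cf f0 If) ?(cdfun_lt cf f0 If).
have dQE : is_derive (cdfun f x) 1 Q (g (Q (cdfun f x)))^-1.
  by rewrite -{1}E; exact: dQ.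
rewrite [f x / _]mulrC.
exact: (@is_derive1_comp _ Q (cdfun f) x _ _ dQE (is_derive_cdfun cf f0 If x)).
Unshelve. all: by end_near. Qed.

End Transport.

(** * Iterated integrals of nonnegative functions of two variables *)

Section IteratedIntegral.
Local Open Scope classical_set_scope.
Context {R : realType}.
Notation mu := (@lebesgue_measure R).
Implicit Types F G : R -> R -> R.

Definition measurable2 F :=
  measurable_fun [set: measurableTypeR R * measurableTypeR R]
    (fun z => F z.1 z.2 : measurableTypeR R).

Definition integral2 F : \bar R := (\int[mu]_x \int[mu]_y (F x y)%:E)%E.

Lemma measurable2_fst (k : R -> R) : measurable_fun setT k -> measurable2 (fun x _ => k x).
Proof. move=> mk; exact: measurableT_comp mk measurable_fst. Qed.

Lemma measurable2_snd (k : R -> R) : measurable_fun setT k -> measurable2 (fun _ y => k y).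
Proof. move=> mk; exact: measurableT_comp mk measurable_snd. Qed.

Lemma measurable2D F G : measurable2 F -> measurable2 G ->
  measurable2 (fun x y => F x y + G x y).
Proof. exact: measurable_funD. Qed.

Lemma measurable2B F G : measurable2 F -> measurable2 G ->
  measurable2 (fun x y => F x y - G x y).
Proof. exact: measurable_funB. Qed.

Lemma measurable2M F G : measurable2 F -> measurable2 G ->
  measurable2 (fun x y => F x y * G x y).
Proof. exact: measurable_funM. Qed.

Lemma measurable2_comp (k : R -> R) F : measurable_fun setT k -> measurable2 F ->
  measurable2 (fun x y => k (F x y)).
Proof. by move=> mk mF; exact: measurableT_comp mk mF. Qed.

Lemma measurable2_swap F : measurable2 F -> measurable2 (fun y x => F x y).
Proof.
move=> mF; exact: (measurableT_comp mF (measurable_fun_pair measurable_snd measurable_fst)).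
Qed.

Lemma measurable2_sum (I : Type) (s : seq I) (F : I -> R -> R -> R) :
  (forall i, measurable2 (F i)) -> measurable2 (fun x y => \sum_(i <- s) F i x y).
Proof. by move=> mF; apply: measurable_sum. Qed.

Lemma measurable2_slice F x : measurable2 F -> measurable_fun setT (F x).
Proof. by move=> /(measurable_fun_pair2 x). Qed.

Let mE F : measurable2 F ->
  measurable_fun [set: measurableTypeR R * measurableTypeR R] (fun z => (F z.1 z.2)%:E).
Proof. by move=> mF; apply/measurable_EFinP. Qed.

Lemma measurable_inner F : measurable2 F -> (forall x y, 0 <= F x y) ->
  measurable_fun [set: measurableTypeR R] (fun x => \int[mu]_y (F x y)%:E)%E.
Proof.
move=> mF F0.
apply: (@measurable_fun_fubini_tonelli_F _ _ _ _ _ mu _ (mE mF)).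
by move=> z; rewrite lee_fin.
Qed.

Lemma inner_ge0 F x : (forall x y, 0 <= F x y) -> (0 <= \int[mu]_y (F x y)%:E)%E.
Proof. by move=> F0; apply: integral_ge0 => y _; rewrite lee_fin. Qed.

Lemma ge0_le_integralT (f g : R -> R) : measurable_fun setT f -> measurable_fun setT g ->
  (forall x, 0 <= f x) -> (forall x, f x <= g x) ->
  (\int[mu]_x (f x)%:E <= \int[mu]_x (g x)%:E)%E.
Proof.
move=> mf mg f0 fg; apply: ge0_le_integral => //.
- by move=> x _; rewrite lee_fin.
- by apply/measurable_EFinP.
- by apply/measurable_EFinP.
- by move=> x _; rewrite lee_fin.
Qed.

Lemma ge0_integralTZl (f : R -> R) c : measurable_fun setT f ->
  (forall x, 0 <= f x) -> 0 <= c ->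
  (\int[mu]_x (c * f x)%:E = c%:E * \int[mu]_x (f x)%:E)%E.
Proof.
move=> mf f0 c0; rewrite -ge0_integralZl_EFin//.
- by move=> x _; rewrite lee_fin.
- by apply/measurable_EFinP.
Qed.

Lemma integral2_le F G : measurable2 F -> measurable2 G ->
  (forall x y, 0 <= F x y) -> (forall x y, F x y <= G x y) ->
  (integral2 F <= integral2 G)%E.
Proof.
move=> mF mG F0 FG.
have G0 x y : 0 <= G x y by exact: le_trans (FG x y).
apply: ge0_le_integral => //.
- by move=> x _; exact: inner_ge0.
- exact: measurable_inner.
- exact: measurable_inner.
- by move=> x _; apply: ge0_le_integralT => //; exact: measurable2_slice.
Qed.

Lemma integral2D F G : measurable2 F -> measurable2 G ->
  (forall x y, 0 <= F x y) -> (forall x y, 0 <= G x y) ->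
  (integral2 (fun x y => F x y + G x y)%R = integral2 F + integral2 G)%E.
Proof.
move=> mF mG F0 G0.
rewrite /integral2 -ge0_integralD//.
- apply: eq_integral => x _.
  rewrite -ge0_integralD//.
  + by move=> y _; rewrite lee_fin.
  + by apply/measurable_EFinP; exact: measurable2_slice.
  + by move=> y _; rewrite lee_fin.
  + by apply/measurable_EFinP; exact: measurable2_slice.
- by move=> x _; exact: inner_ge0.
- exact: measurable_inner.
- by move=> x _; exact: inner_ge0.
- exact: measurable_inner.
Qed.

Lemma integral2Z F c : measurable2 F -> (forall x y, 0 <= F x y) -> 0 <= c ->
  (integral2 (fun x y => c * F x y)%R = c%:E * integral2 F)%E.
Proof.
move=> mF F0 c0; rewrite /integral2 -ge0_integralZl_EFin//.
- by apply: eq_integral => x _; rewrite ge0_integralTZl//; exact: measurable2_slice.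
- by move=> x _; exact: inner_ge0.
- exact: measurable_inner.
Qed.

Lemma integral2_swap F : measurable2 F -> (forall x y, 0 <= F x y) ->
  integral2 F = integral2 (fun y x => F x y).
Proof.
move=> mF F0; apply: (fubini_tonelli _ (mE mF)).
by move=> z; rewrite lee_fin.
Qed.

Lemma integral2_sum (I : Type) (s : seq I) (F : I -> R -> R -> R) :
  (forall i, measurable2 (F i)) -> (forall i x y, 0 <= F i x y) ->
  (integral2 (fun x y => \sum_(i <- s) F i x y)%R = \sum_(i <- s) integral2 (F i))%E.
Proof.
move=> mF F0; elim: s => [|i s IH].
  rewrite big_nil; apply: integral0_eq => x _; apply: integral0_eq => y _.
  by rewrite big_nil.
rewrite big_cons -IH -integral2D; last 4 first.
- exact: mF.
- exact: measurable2_sum.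
- by [].
- by move=> x y; apply: sumr_ge0.
- by apply: eq_integral => x _; apply: eq_integral => y _; rewrite big_cons.
Qed.

Lemma integral_affine (G : R -> R) (a b : R) : continuous G -> (forall x, 0 <= G x) -> 0 < a ->
  (\int[mu]_x (G (a * x + b))%:E = (a^-1)%:E * \int[mu]_x (G x)%:E)%E.
Proof.
move=> cG G0 a0.
pose F (x : R^o) := a * x + b.
have dF (x : R) : is_derive x 1 F a.
  have -> : F = (a \*: id) + cst b by [].
  by apply: is_derive_eq; rewrite addr0 [LHS]mulr1.
have F'E : F^`()%classic = cst a by apply/funext => x; rewrite derive1E derive_val.
have cF : continuous F.
  by move=> x; apply/differentiable_continuous/derivable1_diffP; case: (dF x).
rewrite (@increasing_ge0_integration_by_substitutionT _ F G)//.
- rewrite -ge0_integralTZl//.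
  + apply: eq_integral => x _; rewrite F'E /=; congr EFin.
    by rewrite mulrA mulrAC mulVf ?gt_eqF// mul1r.
  + apply: measurable_funM; rewrite ?F'E//.
    by apply: continuous_measurable_fun => x; apply: continuous_comp; [exact: cF|exact: cG].
  + by move=> x; rewrite F'E; apply: mulr_ge0; [exact: G0|exact: ltW].
  + by rewrite invr_ge0 ltW.
- by move=> x y xy; rewrite /F ltrD2r ltr_pM2l.
- by rewrite F'E => ?; exact: cvg_cst.
- by rewrite F'E; exact: is_cvg_cst.
- by rewrite F'E; exact: is_cvg_cst.
- apply/cvgrNyPle => A; exists (a^-1 * (A - b)); split; first exact: num_real.
  by move=> x /ltW; rewrite ler_pdivlMl// lerBrDr.
- apply/cvgryPge => A; exists (a^-1 * (A - b)); split; first exact: num_real.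
  by move=> x /ltW; rewrite ler_pdivrMl// lerBlDr.
Qed.

End IteratedIntegral.

(** * The sharp Young inequality on the line *)

Section TwoThirds.
Context {R : realType}.
Implicit Types x y : R.

(** The power of exponent 2/3, written as the square of a cube root: it is visibly nonnegative, and
    cubing turns inequalities about it into polynomial ones. *)
Definition pow23 x : R := (x `^ 3^-1) ^+ 2.

Lemma pow23_ge0 x : 0 <= pow23 x. Proof. exact: sqr_ge0. Qed.

Lemma pow23_cube x : 0 <= x -> pow23 x ^+ 3 = x ^+ 2.
Proof.
move=> x0; rewrite /pow23 exprAC -(powR_mulrn 3) ?powR_ge0// -powRrM.
by rewrite mulVf// powRr1.
Qed.

Lemma pow23M x y : 0 <= x -> 0 <= y -> pow23 (x * y) = pow23 x * pow23 y.
Proof. by move=> x0 y0; rewrite /pow23 powRM// exprMn. Qed.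

Lemma pow23_1 : pow23 1 = 1. Proof. by rewrite /pow23 powR1 expr1n. Qed.

Lemma pow23_0 : pow23 0 = 0. Proof. by rewrite /pow23 powR0 ?expr0n// invr_eq0. Qed.

Lemma pow23_leP x y : 0 <= x -> 0 <= y -> (pow23 x <= y) = (x ^+ 2 <= y ^+ 3).
Proof.
by move=> x0 y0; rewrite -pow23_cube// ler_pXn2r// nnegrE// pow23_ge0.
Qed.

Lemma le_pow23 x y : 0 <= x -> x <= y -> pow23 x <= pow23 y.
Proof.
move=> x0 xy; have y0 := le_trans x0 xy.
by rewrite pow23_leP ?pow23_ge0// pow23_cube// ler_pXn2r.
Qed.

Lemma measurable_pow23 : measurable_fun setT pow23.
Proof. by apply: measurable_funX; exact: measurable_powR. Qed.

(* The graph of [pow23] lies below its tangent at [t]. *)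
Lemma pow23_concave (I : Type) (s : seq I) (w a : I -> R) :
  (forall i, 0 <= w i) -> (forall i, 0 <= a i) -> \sum_(i <- s) w i <= 1 ->
  \sum_(i <- s) w i * pow23 (a i) <= pow23 (\sum_(i <- s) w i * a i).
Proof.
move=> w0 a0 W1; set t := (X in _ <= pow23 X).
have t0 : 0 <= t by apply: sumr_ge0 => i _; rewrite mulr_ge0.
(* At [t = 0] the tangent is vertical, so this case is separate: every [w i * a i] vanishes
   there. *)
move: t0; rewrite le_eqVlt => /orP[/eqP t0|t0].
  have -> : pow23 t = 0 by rewrite -t0 pow23_0.
  have wa0 (i : I) : w i * a i = 0 -> w i * pow23 (a i) = 0.
    by move=> /eqP; rewrite mulf_eq0 => /orP[] /eqP ->; rewrite ?mul0r// pow23_0 mulr0.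
  move: t0; rewrite /t {t}; elim: s {W1} => [|i s IH]; first by rewrite !big_nil.
  rewrite !big_cons => /esym /eqP; rewrite paddr_eq0 ?mulr_ge0 ?sumr_ge0//; last first.
    by move=> j _; rewrite mulr_ge0.
  by move=> /andP[/eqP /wa0 -> /eqP/esym/IH]; rewrite add0r.
set q := t `^ 3^-1.
have q0 : 0 < q by rewrite powR_gt0.
have q3 : q ^+ 3 = t by rewrite -powR_mulrn ?powR_ge0// -powRrM mulVf// powRr1// ltW.
have tangent i : w i * pow23 (a i) <= w i * (q ^+ 2 / 3) + (w i * a i) * (2 / 3 / q).
  rewrite -mulrA -mulrDr ler_wpM2l// /pow23; set p := a i `^ _.
  have p0 : 0 <= p by exact: powR_ge0.
  have <- : p ^+ 3 = a i by rewrite -powR_mulrn ?powR_ge0// -powRrM mulVf// powRr1.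
  have -> : q ^+ 2 / 3 + p ^+ 3 * (2 / 3 / q) = p ^+ 2 + (q - p) ^+ 2 * (q + 2 * p) / (3 * q).
    by field; rewrite gt_eqF.
  rewrite lerDl; apply: divr_ge0; last by rewrite mulr_ge0// ltW.
  by apply: mulr_ge0; [exact: sqr_ge0|rewrite addr_ge0 ?mulr_ge0// ltW].
apply: (le_trans (ler_sum _ (fun i _ => tangent i))).
rewrite big_split/= -!mulr_suml -/t (_ : pow23 t = q ^+ 2)// -[in X in _ + X]q3.
have -> : q ^+ 3 * (2 / 3 / q) = q ^+ 2 * (2 / 3) by field; rewrite gt_eqF.
(* The tangent has the nonnegative constant term [q ^+ 2 / 3], so a total weight at most 1 is
   enough. *)
rewrite -[leRHS]mul1r (_ : 1 * q ^+ 2 = 1 * (q ^+ 2 / 3) + q ^+ 2 * (2 / 3)); last by field.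
by rewrite lerD2r ler_wpM2r// divr_ge0 ?sqr_ge0.
Qed.

End TwoThirds.

Section Young.
Context {R : realType}.
Notation mu := (@lebesgue_measure R).

(** The arithmetic-geometric mean inequality for [x], [y], [y]; the difference of the two sides
    factors explicitly. *)
Lemma amgm12 (x y : R) : 0 <= x -> 0 <= y -> x * y ^+ 2 <= ((x + 2 * y) / 3) ^+ 3.
Proof.
move=> x0 y0; rewrite -subr_ge0.
have -> : ((x + 2 * y) / 3) ^+ 3 - x * y ^+ 2 = (x - y) ^+ 2 * (x + 8 * y) / 27 by field.
by rewrite divr_ge0// mulr_ge0 ?sqr_ge0// addr_ge0// mulr_ge0.
Qed.

(** Apply [amgm12] with [y] half of the factor of the last [3^-1]. In [x * y ^+ 2] the parameter [e]
    cancels, and [(a + b) ^+ 2 >= 4 * a * b] leaves the square of the argument of [pow23]. The free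
    [e] is chosen later so that both terms can be integrated. *)
Lemma pow23_amgm (a b p q h e : R) :
  0 <= a -> 0 <= b -> 0 <= p -> 0 <= q -> 0 <= h -> 0 < e ->
  pow23 (a * p * (b * q) * h) <=
  3^-1 * (e ^+ 2 * p ^+ 2 * q ^+ 2 * (a * b)) + 3^-1 * (e^-1 * (a + b) * h).
Proof.
move=> a0 b0 p0 q0 h0 e0.
set x := e ^+ 2 * p ^+ 2 * q ^+ 2 * (a * b).
pose y := e^-1 * (a + b) * h / 2.
have x0 : 0 <= x by rewrite /x !mulr_ge0 ?exprn_ge0 ?(ltW e0).
have y0 : 0 <= y by rewrite /y divr_ge0// !mulr_ge0 ?addr_ge0 ?invr_ge0 ?(ltW e0).
have -> : 3^-1 * x + 3^-1 * (e^-1 * (a + b) * h) = (x + 2 * y) / 3 by rewrite /y; field; rewrite gt_eqF.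
have t0 : 0 <= (x + 2 * y) / 3 by rewrite divr_ge0// addr_ge0// mulr_ge0.
rewrite pow23_leP//; last by rewrite !mulr_ge0.
apply: le_trans (amgm12 x0 y0).
have -> : x * y ^+ 2 = (a * p * (b * q) * h) ^+ 2 + (p * q * h) ^+ 2 * (a * b) * (a - b) ^+ 2 / 4.
  by rewrite /x /y; field; rewrite gt_eqF.
rewrite lerDl; apply: divr_ge0 => //.
by apply: mulr_ge0; [rewrite !mulr_ge0 ?sqr_ge0|exact: sqr_ge0].
Qed.

Lemma integral_gauss_affine (a b : R) : 0 < a ->
  (\int[mu]_x (gauss_fun (a * x + b))%:E = (Num.sqrt pi / a)%:E)%E.
Proof.
move=> a0; rewrite integral_affine//; [|exact: continuous_gauss_fun|exact: gauss_fun_ge0].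
by rewrite integralT_gauss -EFinM mulrC.
Qed.

End Young.

Section Young.
Local Open Scope classical_set_scope.
Context {R : realType}.
Notation mu := (@lebesgue_measure R).

(** * Barthe's argument for functions with the mass of the Gaussian *)

Section Normalized.
Variables f g h : R -> R.
Hypotheses (cf : continuous f) (cg : continuous g) (ch : continuous h).
Hypotheses (f0 : forall x, 0 < f x) (g0 : forall x, 0 < g x) (h0 : forall x, 0 <= h x).
Hypothesis If : (\int[mu]_x (f x)%:E = (Num.sqrt pi)%:E)%E.
Hypothesis Ig : (\int[mu]_x (g x)%:E = (Num.sqrt pi)%:E)%E.
Hypothesis Ih : (\int[mu]_x (h x)%:E = (Num.sqrt pi)%:E)%E.

Let s3 : R := Num.sqrt 3.
Let s3_gt0 : 0 < s3. Proof. by rewrite sqrtr_gt0. Qed.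
Let s3_sqr : s3 ^+ 2 = 3. Proof. by rewrite sqr_sqrtr. Qed.

Variables U V : R -> R.
Let a x := f x / gauss_fun (U x).
Let b x := g x / gauss_fun (V x).
Hypothesis dU : forall x : R, is_derive x 1 U (a x).
Hypothesis dV : forall x : R, is_derive x 1 V (b x).

Let gauss_gt0 (x : R) : 0 < gauss_fun x. Proof. exact: expR_gt0. Qed.
Let a0 x : 0 < a x. Proof. by rewrite divr_gt0. Qed.
Let b0 x : 0 < b x. Proof. by rewrite divr_gt0. Qed.

Let cU : continuous U.
Proof. by move=> x; apply/differentiable_continuous/derivable1_diffP; case: (dU x). Qed.
Let cV : continuous V.
Proof. by move=> x; apply/differentiable_continuous/derivable1_diffP; case: (dV x). Qed.

Let cgauss (W : R -> R) : continuous W -> continuous (fun x => gauss_fun (W x)).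
Proof. by move=> cW x; apply: continuous_comp; [exact: cW|exact: continuous_gauss_fun]. Qed.

Let ca : continuous a.
Proof.
move=> x; apply: cvgM; first exact: cf.
by apply: cvgV; [rewrite gt_eqF|exact: cgauss].
Qed.
Let cb : continuous b.
Proof.
move=> x; apply: cvgM; first exact: cg.
by apply: cvgV; [rewrite gt_eqF|exact: cgauss].
Qed.

(* The two majorants: the first one is a Gaussian pulled back by [(U, V)], the
   second one is integrated along the lines [x - y = w], on which it is a
   derivative. *)
Let A x y := gauss_fun (U x) * a x * (gauss_fun (2 / s3 * V y + - (U x / s3)) * b y).
Let B x y := gauss_fun ((U x + V y) / s3) * (a x + b y) * h (x - y).

Let mc (k : R -> R) : continuous k -> measurable_fun setT k.
Proof. exact: continuous_measurable_fun. Qed.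

Let mdiff : @measurable2 R (fun x y => x - y).
Proof. by apply: measurable2B; [apply: (measurable2_fst (k := id))|apply: (measurable2_snd (k := id))]. Qed.

Let mgauss : measurable_fun setT (@gauss_fun R).
Proof. exact: measurable_gauss_fun. Qed.

Let mA : measurable2 A.
Proof.
apply: measurable2M.
  by apply: measurable2_fst; apply: measurable_funM; apply: mc => //; exact: cgauss.
apply: measurable2M; last by apply: measurable2_snd; exact: mc.
apply: measurable2_comp => //; apply: measurable2D.
  by apply: measurable2_snd; apply: measurable_funM => //; exact: mc.
apply: measurable2_fst; apply: measurable_funN; apply: measurable_funM => //; exact: mc.
Qed.

Let mB : measurable2 B.
Proof.
apply: measurable2M; last by apply: measurable2_comp => //; exact: mc.
apply: measurable2M.
  apply: measurable2_comp => //; apply: measurable2M.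
    by apply: measurable2D; [apply: measurable2_fst|apply: measurable2_snd]; exact: mc.
  by apply: (measurable2_fst (k := cst s3^-1)).
by apply: measurable2D; [apply: measurable2_fst|apply: measurable2_snd]; exact: mc.
Qed.

Let A0 x y : 0 <= A x y.
Proof.
by apply: mulr_ge0; apply: mulr_ge0; rewrite ?gauss_fun_ge0// ltW.
Qed.

Let B0 x y : 0 <= B x y.
Proof.
apply: mulr_ge0 => //; apply: mulr_ge0; first exact: gauss_fun_ge0.
by rewrite ltW// addr_gt0.
Qed.

Let pointwise x y : pow23 (f x * g y * h (x - y)) <= 3^-1 * A x y + 3^-1 * B x y.
Proof.
(* This choice makes the exponents complete squares: [2 (U + V)^2 / 3 - 2 U^2 - 2 V^2 = - U^2 - (2 V
   - U)^2 / 3], so that the first majorant is a product of Gaussians. *)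
pose e := expR (((U x + V y) / s3) ^+ 2).
have -> : f x = a x * gauss_fun (U x) by rewrite /a divfK ?gt_eqF.
have -> : g y = b y * gauss_fun (V y) by rewrite /b divfK ?gt_eqF.
have := @pow23_amgm R (a x) (b y) (gauss_fun (U x)) (gauss_fun (V y)) (h (x - y)) e
  (ltW (a0 x)) (ltW (b0 y)) (ltW (gauss_gt0 _)) (ltW (gauss_gt0 _)) (h0 _) (expR_gt0 _).
have EA : e ^+ 2 * gauss_fun (U x) ^+ 2 * gauss_fun (V y) ^+ 2 * (a x * b y) = A x y.
  rewrite /A [RHS]mulrACA; congr (_ * _).
  rewrite /e /gauss_fun -!expRM_natl -!exp.expRD; congr expR.
  have E3 : s3^-1 ^+ 2 = 3^-1 by rewrite exprVn s3_sqr.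
  have -> : ((U x + V y) / s3) ^+ 2 = (U x + V y) ^+ 2 * 3^-1 by rewrite exprMn E3.
  have -> : (2 / s3 * V y + - (U x / s3)) ^+ 2 = (2 * V y - U x) ^+ 2 * 3^-1.
    by rewrite -E3; ring.
  by field.
have EB : e^-1 * (a x + b y) * h (x - y) = B x y by rewrite /B /e /gauss_fun expRN.
by rewrite EA EB.
Qed.

(** Two successive substitutions. The inner one, by [V], produces a Gaussian of slope [2 / s3] whose
    mass does not depend on the shift [U x / s3]; the outer one, by [U], produces the standard
    Gaussian. *)
Let intA : (integral2 A <= (s3 / 2 * pi)%:E)%E.
Proof.
apply: (@le_trans _ _ (\int[mu]_x (gauss_fun (U x) * a x * (Num.sqrt pi / (2 / s3)))%:E)%E).
  apply: ge0_le_integral => //.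
  - by move=> x _; apply: inner_ge0.
  - exact: measurable_inner.
  - apply/measurable_EFinP; apply: measurable_funM => //.
    by apply: measurable_funM; apply: mc => //; exact: cgauss.
  - move=> x _.
    have gU : 0 <= gauss_fun (U x) * a x by apply: mulr_ge0; rewrite ?gauss_fun_ge0// ltW.
    rewrite ge0_integralTZl//; last 2 first.
    + apply: measurable_funM; last exact: mc.
      apply: mc; apply: cgauss => y; apply: cvgD; last exact: cvg_cst.
      by apply: cvgM; [exact: cvg_cst|exact: cV].
    + by move=> y; apply: mulr_ge0; rewrite ?gauss_fun_ge0// ltW.
    rewrite [leRHS]EFinM lee_wpmul2l ?lee_fin//.
    pose G (t : R) := gauss_fun (2 / s3 * t + - (U x / s3)).
    rewrite -(@integral_gauss_affine R (2 / s3) (- (U x / s3))) ?divr_gt0//.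
    apply: (@integral_substitution_le _ V b G) => //.
    + exact: gt0_is_derive_homo dV b0.
    + apply: cgauss => y; apply: cvgD; last exact: cvg_cst.
      by apply: cvgM; [exact: cvg_cst|exact: cvg_id].
    + by move=> t; exact: gauss_fun_ge0.
under eq_integral do rewrite mulrC.
rewrite ge0_integralTZl//; last 3 first.
- by apply: measurable_funM; apply: mc => //; exact: cgauss.
- by move=> x; apply: mulr_ge0; rewrite ?gauss_fun_ge0// ltW.
- by rewrite divr_ge0 ?sqrtr_ge0 ?divr_ge0 ?ltW.
have -> : s3 / 2 * pi = Num.sqrt pi / (2 / s3) * Num.sqrt pi.
  by rewrite -[in LHS](sqr_sqrtr (pi_ge0 R)); field; rewrite gt_eqF.
rewrite [leRHS]EFinM lee_wpmul2l ?lee_fin ?divr_ge0 ?sqrtr_ge0 ?divr_ge0 ?(ltW s3_gt0)//.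
rewrite -integralT_gauss; apply: integral_substitution_le => //.
- exact: gt0_is_derive_homo dU a0.
- exact: continuous_gauss_fun.
- exact: gauss_fun_ge0.
Qed.

Let intB : (integral2 B <= (s3 * pi)%:E)%E.
Proof.
rewrite integral2_swap//.
(* With [x = w + y] the factor [h (x - y)] becomes [h w]. After exchanging the integrals it comes
   out, and [a + b] is the derivative in [y] of [U (w + y) + V y]. *)
have -> : integral2 (fun y x => B x y) = integral2 (fun y w => B (w + y) y).
  apply: eq_integral => y _.
  have := @integral_affine R (fun x => B x y) 1 y.
  rewrite invr1 mul1e => <-//.
  - by under eq_integral do rewrite mul1r.
  - move=> x; apply: cvgM; last first.
      apply: continuous_comp; last exact: ch.
      by apply: cvgB; [exact: cvg_id|exact: cvg_cst].
    apply: cvgM.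
      apply: (cgauss (W := fun z => (U z + V y) / s3)) => z; apply: cvgM; last exact: cvg_cst.
      by apply: cvgD; [exact: cU|exact: cvg_cst].
    by apply: cvgD; [exact: ca|exact: cvg_cst].
have cadd w : continuous (fun y : R => w + y).
  by move=> y; apply: cvgD; [exact: cvg_cst|exact: cvg_id].
have caddU (k : R -> R) w : continuous k -> continuous (fun y => k (w + y)).
  by move=> ck y; apply: continuous_comp; [exact: cadd|exact: ck].
have madd : @measurable2 R (fun y w => w + y).
  by apply: measurable2D; [apply: (measurable2_snd (k := id))|apply: (measurable2_fst (k := id))].
have mBt : measurable2 (fun y w => B (w + y) y).
  apply: measurable2M; last first.
    apply: measurable2_comp; first exact: mc.
    by apply: measurable2B => //; apply: (measurable2_fst (k := id)).
  apply: measurable2M.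
    apply: measurable2_comp => //; apply: measurable2M.
      apply: measurable2D; last by apply: measurable2_fst; exact: mc.
      by apply: measurable2_comp => //; exact: mc.
    by apply: (measurable2_fst (k := cst s3^-1)).
  apply: measurable2D; last by apply: measurable2_fst; exact: mc.
  by apply: measurable2_comp => //; exact: mc.
rewrite (integral2_swap mBt)//.
apply: (@le_trans _ _ (\int[mu]_w (h w * (Num.sqrt pi * s3))%:E)%E); last first.
  under eq_integral do rewrite mulrC.
  rewrite ge0_integralTZl//; last 2 first.
  - exact: mc.
  - by rewrite mulr_ge0 ?sqrtr_ge0.
  rewrite Ih -EFinM lee_fin -[in leRHS](sqr_sqrtr (pi_ge0 R)) expr2.
  by rewrite mulrAC mulrC.
apply: ge0_le_integral => //.
- by move=> x _; apply: integral_ge0 => y _; rewrite lee_fin.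
- by apply: (measurable_inner (measurable2_swap mBt)) => x y; exact: B0.
- by apply/measurable_EFinP; apply: measurable_funM => //; exact: mc.
- move=> w _.
  pose Z y := U (w + y) + V y.
  have dZ (y : R) : is_derive y 1 Z (a (w + y) + b y).
    apply: is_deriveD.
    have -> : a (w + y) = a (w + y) * 1 by rewrite mulr1.
    apply: (@is_derive1_comp _ U (fun y => w + y) y) => //.
    have -> : (fun y : R => w + y) = cst w + id by [].
    by apply: is_derive_eq; rewrite add0r.
  have cZ : continuous (fun y => a (w + y) + b y).
    by move=> y; apply: cvgD; [exact: caddU|exact: cb].
  have BE y : B (w + y) y = h w * (gauss_fun (Z y / s3) * (a (w + y) + b y)).
    by rewrite /B addrK mulrC.
  under eq_integral do rewrite BE.
  rewrite ge0_integralTZl//; last 2 first.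
  - apply: measurable_funM; last exact: mc.
    apply: mc; apply: cgauss => y; apply: cvgM; last exact: cvg_cst.
    by apply: cvgD; [exact: caddU|exact: cV].
  - by move=> y; apply: mulr_ge0; rewrite ?gauss_fun_ge0// ltW// addr_gt0.
  rewrite [leRHS]EFinM lee_wpmul2l ?lee_fin//.
  pose G (t : R) := gauss_fun (s3^-1 * t + 0).
  have -> : Num.sqrt pi * s3 = Num.sqrt pi / s3^-1 by rewrite invrK.
  rewrite -(@integral_gauss_affine R s3^-1 0) ?invr_gt0//.
  have := @integral_substitution_le _ Z (fun y => a (w + y) + b y) G.
  rewrite /G => H.
  under eq_integral do rewrite -[Z _ / s3]addr0 [Z _ / s3]mulrC.
  apply: H => //.
  + by apply: gt0_is_derive_homo dZ _ => y; rewrite addr_gt0.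
  + apply: cgauss => y; apply: cvgD; last exact: cvg_cst.
    by apply: cvgM; [exact: cvg_cst|exact: cvg_id].
  + by move=> t; exact: gauss_fun_ge0.
Qed.

Lemma young_transported :
  (integral2 (fun x y => pow23 (f x * g y * h (x - y)))%R <= (Num.sqrt 3 / 2 * pi)%:E)%E.
Proof.
have mF : measurable2 (fun x y => pow23 (f x * g y * h (x - y))).
  apply: measurable2_comp; first exact: measurable_pow23.
  apply: measurable2M; last by apply: measurable2_comp => //; exact: mc.
  by apply: measurable2M; [apply: measurable2_fst|apply: measurable2_snd]; exact: mc.
have mZ F : measurable2 F -> measurable2 (fun x y => 3^-1 * F x y).
  by move=> mF'; apply: measurable2M => //; apply: (measurable2_fst (k := cst 3^-1)).
apply: (@le_trans  _ _ (integral2 (fun x y => 3^-1 * A x y + 3^-1 * B x y)%R)).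
  apply: integral2_le => //.
  - by apply: measurable2D; exact: mZ.
  - by move=> x y; exact: pow23_ge0.
rewrite integral2D; [|exact: mZ|exact: mZ|by move=> x y; exact: mulr_ge0|by move=> x y; exact: mulr_ge0].
rewrite !integral2Z//.
(* The sharp constant appears here: a third of [1 / 2 + 1] is [1 / 2]. *)
have -> : Num.sqrt 3 / 2 * pi = 3^-1 * (s3 / 2 * pi) + 3^-1 * (s3 * pi) by rewrite /s3; field.
by rewrite EFinD (EFinM 3^-1 (s3 / 2 * pi)) (EFinM 3^-1 (s3 * pi)) leeD ?lee_wpmul2l ?lee_fin.
Qed.

End Normalized.

(** Both sides are homogeneous of degree 2/3 in each function, so all masses may be scaled to
    [sqrt pi]. Then [f] and [g], being positive, are transported to the Gaussian. *)
Theorem young_2_3 (f g h : R -> R) (A B C : R) :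
  continuous f -> continuous g -> continuous h ->
  (forall x, 0 < f x) -> (forall x, 0 < g x) -> (forall x, 0 <= h x) ->
  (\int[mu]_x (f x)%:E = A%:E)%E -> (\int[mu]_x (g x)%:E = B%:E)%E ->
  (\int[mu]_x (h x)%:E = C%:E)%E -> 0 < A -> 0 < B -> 0 < C ->
  (integral2 (fun x y => pow23 (f x * g y * h (x - y)))%R <=
   (Num.sqrt 3 / 2 * pow23 (A * B * C))%:E)%E.
Proof.
move=> cf cg ch f0 g0 h0 If Ig Ih A0 B0 C0.
pose r : R := Num.sqrt pi.
have r0 : 0 < r by rewrite sqrtr_gt0 pi_gt0.
have r2 : r ^+ 2 = pi by rewrite sqr_sqrtr// pi_ge0.
have c_scale (k : R -> R) c : continuous k -> continuous (fun x => c * k x).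
  by move=> ck x; apply: cvgM; [exact: cvg_cst|exact: ck].
have I_scale (k : R -> R) c : continuous k -> (forall x, 0 <= k x) -> 0 < c ->
    (\int[mu]_x (k x)%:E = c%:E)%E -> (\int[mu]_x (r / c * k x)%:E = r%:E)%E.
  move=> ck k0 c0 Ik; rewrite ge0_integralTZl//.
  - by rewrite Ik -EFinM divfK ?gt_eqF.
  - exact: continuous_measurable_fun.
  - by rewrite divr_ge0 ?ltW.
have p_scale (k : R -> R) c : (forall x, 0 < k x) -> 0 < c -> forall x, 0 < r / c * k x.
  by move=> k0 c0 x; rewrite mulr_gt0 ?divr_gt0.
have [U dU] := monotone_transport (c_scale _ (r / A) cf) (p_scale _ _ f0 A0)
  (I_scale _ _ cf (fun x => ltW (f0 x)) A0 If)
  (@continuous_gauss_fun R) (fun x => expR_gt0 _) integralT_gauss.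
have [V dV] := monotone_transport (c_scale _ (r / B) cg) (p_scale _ _ g0 B0)
  (I_scale _ _ cg (fun x => ltW (g0 x)) B0 Ig)
  (@continuous_gauss_fun R) (fun x => expR_gt0 _) integralT_gauss.
have h0' x : 0 <= r / C * h x by apply: mulr_ge0 => //; rewrite divr_ge0// ltW.
have := young_transported (c_scale _ _ cf) (c_scale _ _ cg) (c_scale _ (r / C) ch)
  (p_scale _ _ f0 A0) (p_scale _ _ g0 B0) h0' (I_scale _ _ ch h0 C0 Ih) dU dV.
(* The factor that the scaling puts on the left side; [l * pow23 (A * B * C) = pow23 (r ^+ 3) = pi]
   matches the normalized bound. *)
pose l := pow23 (r / A * (r / B) * (r / C)).
have l0 : 0 < l.
  rewrite lt_neqAle pow23_ge0 andbT eq_sym -[_ == 0](expf_eq0 _ 3) pow23_cube.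
    by rewrite expf_eq0/= gt_eqF// !mulr_gt0 ?invr_gt0.
  by rewrite !mulr_ge0 ?invr_ge0 ?ltW.
have lE : l * pow23 (A * B * C) = pi.
  rewrite -pow23M; last 2 first.
  - by rewrite !mulr_ge0 ?invr_ge0 ?ltW.
  - by rewrite !mulr_ge0 ?ltW.
  have -> : r / A * (r / B) * (r / C) * (A * B * C) = r ^+ 3 by field; rewrite !gt_eqF.
  apply: (@pexpIrn _ 3) => //; rewrite ?nnegrE ?pow23_ge0 ?pi_ge0//.
  by rewrite pow23_cube ?exprn_ge0 ?ltW// -r2 exprAC.
have -> : integral2 (fun x y => pow23 (r / A * f x * (r / B * g y) * (r / C * h (x - y)))) =
    integral2 (fun x y => l * pow23 (f x * g y * h (x - y))).
  apply: eq_integral => x _; apply: eq_integral => y _; congr EFin.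
  rewrite -pow23M ?mulr_ge0 ?invr_ge0 ?(ltW r0) ?(ltW A0) ?(ltW B0) ?(ltW C0) ?(ltW (f0 _)) ?(ltW (g0 _))//.
  by congr pow23; ring.
rewrite integral2Z ?(ltW l0)//; last 2 first.
- apply: measurable2_comp; first exact: measurable_pow23.
  apply: measurable2M; last first.
    apply: measurable2_comp; first exact: continuous_measurable_fun.
    by apply: measurable2B; [apply: (measurable2_fst (k := id))|apply: (measurable2_snd (k := id))].
  by apply: measurable2M; [apply: measurable2_fst|apply: measurable2_snd]; exact: continuous_measurable_fun.
- by move=> x y; exact: pow23_ge0.
rewrite -lE => H; rewrite -(@lee_pmul2l _ l%:E)//.
by rewrite -EFinM [l * _]mulrCA.
Qed.


End Young.

(** * A discrete kernel *)

Section Hat.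
Local Open Scope classical_set_scope.
Context {R : realType}.
Notation mu := (@lebesgue_measure R).

(** Truncation of [x] to [[0, 1]], in a form whose continuity is immediate. As a difference of
    shifted ramps, [hat] is the tent on [[-1, 1]] with peak 1 at 0, and sums of its integer
    translates telescope to a partition of unity. *)
Definition ramp (x : R) : R := (`|x| - `|x - 1| + 1) / 2.
Definition hat (x : R) : R := ramp (x + 1) - ramp x.

Lemma ramp_cases (x : R) :
  (x <= 0 /\ ramp x = 0) \/ (0 <= x <= 1 /\ ramp x = x) \/ (1 <= x /\ ramp x = 1).
Proof.
rewrite /ramp.
have [x0|x0] := leP x 0.
  left; split => //; rewrite ler0_norm// ler0_norm; last lra.
  by field.
have [x1|x1] := leP x 1.
  right; left; split; first by rewrite ltW.
  by rewrite ger0_norm ?(ltW x0)// ler0_norm; [field|lra].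
right; right; split; first exact: ltW.
by rewrite ger0_norm ?(ltW x0)// ger0_norm; [field|lra].
Qed.

Ltac ramps x := have [[? ->]|[[/andP[? ?] ->]|[? ->]]] := ramp_cases x.

Lemma hat_ge0 (x : R) : 0 <= hat x.
Proof. by rewrite /hat; ramps (x + 1); ramps x; lra. Qed.

Lemma hat_le1 (x : R) : hat x <= 1.
Proof. by rewrite /hat; ramps (x + 1); ramps x; lra. Qed.

Lemma hat_eq0 (x : R) : 1 <= `|x| -> hat x = 0.
Proof.
by rewrite ler_normr /hat => /orP[] ?; ramps (x + 1); ramps x; lra.
Qed.

Lemma hat_ge_half (x : R) : `|x| <= 2^-1 -> 2^-1 <= hat x.
Proof.
by rewrite ler_norml /hat => /andP[? ?]; ramps (x + 1); ramps x; lra.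
Qed.

Lemma continuous_hat : continuous hat.
Proof.
have cr : continuous ramp.
  move=> x; apply: cvgM; last exact: cvg_cst.
  apply: cvgD; last exact: cvg_cst.
  apply: cvgB; first by apply: cvg_norm; exact: cvg_id.
  by apply: cvg_norm; apply: cvgB; [exact: cvg_id|exact: cvg_cst].
move=> x; apply: cvgB; last exact: cr.
apply: (@cvg_comp _ _ _ (fun x => x + 1) ramp _ (nbhs (x + 1))); last exact: cr.
by apply: cvgD; [exact: cvg_id|exact: cvg_cst].
Qed.

Lemma sum_hat (M : nat) (x : R) :
  \sum_(i < (2 * M).+1) hat (x - (i%:R - M%:R)) = ramp (x + M%:R + 1) - ramp (x - M%:R).
Proof.
rewrite -(big_mkord xpredT (fun i => hat (x - (i%:R - M%:R)))).
under eq_bigr => i _.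
  rewrite /hat (_ : x - (i%:R - M%:R) + 1 = x + M%:R + 1 - i%:R); last by ring.
  rewrite (_ : x - (i%:R - M%:R) = x + M%:R + 1 - i.+1%:R); last by rewrite -natr1; ring.
  over.
rewrite (eq_bigr (fun i => - ramp (x + M%:R + 1 - i.+1%:R) - - ramp (x + M%:R + 1 - i%:R))).
  rewrite (telescope_sumr (fun i => - ramp (x + M%:R + 1 - i%:R)))//.
  by rewrite opprK addrC subr0 -natr1 natrM; congr (_ - ramp _); ring.
by move=> i _; rewrite opprK addrC.
Qed.

Lemma sum_hat_le1 (M : nat) (x : R) : \sum_(i < (2 * M).+1) hat (x - (i%:R - M%:R)) <= 1.
Proof.
rewrite sum_hat.
by ramps (x + M%:R + 1); ramps (x - M%:R); lra.
Qed.

Lemma sum_hat_eq1 (M : nat) (x : R) : `|x| <= M%:R ->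
  \sum_(i < (2 * M).+1) hat (x - (i%:R - M%:R)) = 1.
Proof.
rewrite sum_hat ler_norml => /andP[? ?].
by ramps (x + M%:R + 1); ramps (x - M%:R); lra.
Qed.

Definition hat_mass : R := fine (\int[mu]_x (hat x)%:E)%E.

Let mhat : measurable_fun setT hat.
Proof. exact: continuous_measurable_fun continuous_hat. Qed.

Lemma integral_hat : (\int[mu]_x (hat x)%:E = hat_mass%:E)%E.
Proof.
rewrite /hat_mass fineK// ge0_fin_numE; last first.
  by apply: integral_ge0 => x _; rewrite lee_fin hat_ge0.
(* On [[-1, 1]] the function [exp (1 - x^2)] is at least 1, hence dominates the tent. *)
apply: (@le_lt_trans _ _ (\int[mu]_x (expR 1 * gauss_fun x)%:E)%E).
  apply: ge0_le_integralT => //; first by apply: measurable_funM => //; exact: measurable_gauss_fun.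
    exact: hat_ge0.
  move=> x; rewrite /gauss_fun -exp.expRD.
  have [x1|x1] := leP 1 `|x|; first by rewrite hat_eq0// expR_ge0.
  rewrite (le_trans (hat_le1 x))// -[leLHS]exp.expR0 ler_expR subr_ge0 -real_normK ?num_real//.
  by rewrite expr_le1// ltW.
rewrite ge0_integralTZl; [|exact: measurable_gauss_fun|exact: gauss_fun_ge0|exact: expR_ge0].
by rewrite integralT_gauss -EFinM ltry.
Qed.

Lemma hat_mass_gt0 : 0 < hat_mass.
Proof.
rewrite -lte_fin -integral_hat.
apply: (@lt_le_trans _ _ (\int[mu]_(x in `[(- 2^-1)%R, (2^-1)%R]) (hat x)%:E)%E); last first.
  apply: ge0_subset_integral => //; first by apply/measurable_EFinP.
  by move=> x _; rewrite lee_fin hat_ge0.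
apply: (@lt_le_trans _ _ (\int[mu]_(x in `[(- 2^-1)%R, (2^-1)%R]) (2^-1)%:E)%E).
  rewrite integral_cst//= lebesgue_measure_itv/= lte_fin.
  rewrite ifT; last by lra.
  by rewrite -EFinD -EFinM lte_fin; lra.
apply: ge0_le_integral => //.
- by apply/measurable_EFinP; exact: measurable_funTS.
- by move=> x; rewrite /= in_itv/= lee_fin -ler_norml => /hat_ge_half.
Qed.

Lemma integral_hat_shift (c : R) : (\int[mu]_x (hat (x - c))%:E = hat_mass%:E)%E.
Proof.
have := @integral_affine R hat 1 (- c) continuous_hat hat_ge0 ltr01.
by rewrite invr1 mul1e integral_hat => <-; apply: eq_integral => x _; rewrite mul1r.
Qed.

End Hat.

(** * From Young's inequality on the line to a kernel on integers *)

Section YoungKernel.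
Local Open Scope classical_set_scope.
Context {R : realType}.
Notation mu := (@lebesgue_measure R).

(** Discrete form of the inequality: the weight [w i j k] tells to what extent [k] stands for the
    difference of [i] and [j]. The next lemmas build such a kernel concentrated near [k = i - j]. *)
Definition young_kernel (I : finType) (w : I -> I -> I -> R) (c : R) :=
  forall f g h : I -> R, (forall i, 0 <= f i) -> (forall i, 0 <= g i) -> (forall i, 0 <= h i) ->
  \sum_i \sum_j \sum_k w i j k * pow23 (f i * g j * h k) <=
  c * pow23 ((\sum_i f i) * (\sum_j g j) * (\sum_k h k)).

(** Removes the Gaussian perturbation that makes the interpolated functions positive. After cubing,
    the bound is a polynomial in [e], hence continuous at 0. *)
Lemma le_pow23_lim (x c a1 a2 a3 s : R) : 0 <= x -> 0 <= c -> 0 <= a1 -> 0 <= a2 -> 0 <= a3 ->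
  0 <= s ->
  (forall e, 0 < e -> x <= c * pow23 ((a1 + e * s) * (a2 + e * s) * (a3 + e * s))) ->
  x <= c * pow23 (a1 * a2 * a3).
Proof.
move=> x0 c0 a10 a20 a30 s0 H.
have p0 : 0 <= c * pow23 (a1 * a2 * a3) by rewrite mulr_ge0 ?pow23_ge0.
rewrite -(@ler_pXn2r _ 3)// exprMn pow23_cube ?mulr_ge0//.
pose P (e : R) := c ^+ 3 * ((a1 + e * s) * (a2 + e * s) * (a3 + e * s)) ^+ 2.
have cP : continuous P.
  move=> e; apply: cvgM; first exact: cvg_cst.
  have cl (a : R) : a + e' * s @[e' --> e] --> a + e * s.
    by apply: cvgD; [exact: cvg_cst|apply: cvgM; [exact: cvg_id|exact: cvg_cst]].
  by rewrite expr2; under eq_cvg do rewrite expr2; apply: cvgM; apply: cvgM => //; apply: cvgM.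
have -> : c ^+ 3 * (a1 * a2 * a3) ^+ 2 = P 0 by rewrite /P !mul0r !addr0.
have cv : P e @[e --> 0^'+] --> P 0 by exact/cvg_at_right_filter/cP.
rewrite -(cvg_lim _ cv)//; apply: limr_ge; first exact: (cvgP _ cv).
near=> e.
  have e0 : 0 < e by near: e; exact: nbhs_right_gt.
  have A0 a : 0 <= a -> 0 <= a + e * s by move=> a0; rewrite addr_ge0// mulr_ge0// ltW.
  rewrite /P -pow23_cube; last by rewrite !mulr_ge0 ?A0.
  by rewrite -exprMn ler_pXn2r ?nnegrE ?H// mulr_ge0 ?pow23_ge0.
Unshelve. all: by end_near. Qed.

Section Kernel.
Variable M : nat.
Let J := 'I_(2 * M).+1.
Let pos (i : J) : R := i%:R - M%:R.
Let c : R := Num.sqrt 3 / 2.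
Let B : R := hat_mass.

Let mhat : measurable_fun setT (@hat R).
Proof. exact: continuous_measurable_fun continuous_hat. Qed.

Let mhat1 p : @measurable2 R (fun x y => hat (x - p)).
Proof.
apply: (measurable2_fst (k := fun x => hat (x - p))).
by apply: measurableT_comp => //; apply: measurable_funB.
Qed.

Let mhat2 p : @measurable2 R (fun x y => hat (y - p)).
Proof.
apply: (measurable2_snd (k := fun x => hat (x - p))).
by apply: measurableT_comp => //; apply: measurable_funB.
Qed.

Let mhat3 p : @measurable2 R (fun x y => hat (x - y - p)).
Proof.
apply: measurable2_comp => //; apply: measurable2B; last exact: (measurable2_fst (k := cst p)).
by apply: measurable2B; [apply: (measurable2_fst (k := id))|apply: (measurable2_snd (k := id))].
Qed.

Let T i j k (x y : R) := hat (x - pos i) * hat (y - pos j) * hat (x - y - pos k).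

Let mT i j k : measurable2 (T i j k).
Proof. by apply: measurable2M => //; apply: measurable2M. Qed.

Let T0 i j k x y : 0 <= T i j k x y.
Proof. by rewrite /T !mulr_ge0 ?hat_ge0. Qed.

Let integral2_hat2 p q : integral2 (fun x y : R => hat (x - p) * hat (y - q)) = (B ^+ 2)%:E.
Proof.
rewrite /integral2.
under eq_integral => x _.
  rewrite ge0_integralTZl; [|by apply: measurableT_comp => //; apply: measurable_funB|
    by move=> y; exact: hat_ge0|exact: hat_ge0].
  rewrite integral_hat_shift -EFinM mulrC.
  over.
rewrite ge0_integralTZl; [|by apply: measurableT_comp => //; apply: measurable_funB|
  by move=> y; exact: hat_ge0|exact/ltW/hat_mass_gt0].
by rewrite integral_hat_shift -EFinM expr2.
Qed.

Let W i j k : R := fine (integral2 (T i j k)).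

Let WE i j k : integral2 (T i j k) = (W i j k)%:E.
Proof.
rewrite /W fineK// ge0_fin_numE; last first.
  by apply: integral_ge0 => x _; apply: integral_ge0 => y _; rewrite lee_fin T0.
apply: (@le_lt_trans _ _ (integral2 (fun x y : R => hat (x - pos i) * hat (y - pos j)))).
  apply: integral2_le => //; first by apply: measurable2M.
  by move=> x y; rewrite /T ler_piMr ?hat_le1// mulr_ge0 ?hat_ge0.
by rewrite integral2_hat2 ltry.
Qed.

Let W0 i j k : 0 <= W i j k.
Proof.
by rewrite -lee_fin -WE; apply: integral_ge0 => x _; apply: integral_ge0 => y _; rewrite lee_fin T0.
Qed.

Let W_eq0 i j k : 3 <= `|pos k - (pos i - pos j)| -> W i j k = 0.
Proof.
move=> H; suff : integral2 (T i j k) = 0%E by rewrite WE => -[].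
apply: integral0_eq => x _; apply: integral0_eq => y _; congr EFin.
apply/eqP; rewrite /T !mulf_eq0 -orbA; apply/or3P.
have [h1|h1] := leP 1 `|x - pos i|; first by constructor; rewrite hat_eq0.
have [h2|h2] := leP 1 `|y - pos j|; first by constructor; rewrite hat_eq0.
constructor 3; rewrite hat_eq0//.
move: H h1 h2; rewrite !ltr_norml !ler_normr => H /andP[? ?] /andP[? ?].
by case/orP: H => ?; apply/orP; [right|left]; lra.
Qed.

(** On the supports of the first two tents [|x - y| <= M], so the tents indexed by [k] sum to 1
    there and a product of two tent masses remains. *)
Let W_sum i j : `|pos i| + `|pos j| + 2 <= M%:R -> \sum_k W i j k = B ^+ 2.
Proof.
move=> H; apply/EFin_inj; rewrite -sumEFin.
under eq_bigr do rewrite -WE.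
rewrite -integral2_sum// -(integral2_hat2 (pos i) (pos j)).
apply: eq_integral => x _; apply: eq_integral => y _; congr EFin.
rewrite /T -mulr_sumr.
have [h1|h1] := leP 1 `|x - pos i|; first by rewrite hat_eq0// !mul0r.
have [h2|h2] := leP 1 `|y - pos j|; first by rewrite (hat_eq0 h2) mulr0 mul0r.
rewrite sum_hat_eq1 ?mulr1// (le_trans _ H)//.
have -> : x - y = (x - pos i) - (y - pos j) + (pos i - pos j) by ring.
apply: le_trans (ler_normD _ _) _.
apply: le_trans (lerD (ler_normB _ _) (ler_normB _ _)) _.
by move: h1 h2; lra.
Qed.

(** Piecewise linear interpolation of [f], with a small Gaussian added because transport asks for
    positive densities. *)
Let phi (f : J -> R) (e x : R) := \sum_i f i * hat (x - pos i) + e * gauss_fun x.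

Let phi_cont f e : continuous (phi f e).
Proof.
move=> x; apply: cvgD.
  apply: cvg_big => [|i _]; first exact: add_continuous.
  apply: cvgM; first exact: cvg_cst.
  apply: (@cvg_comp _ _ _ (fun x => x - pos i) hat _ (nbhs (x - pos i))); last exact: continuous_hat.
  by apply: cvgB; [exact: cvg_id|exact: cvg_cst].
by apply: cvgM; [exact: cvg_cst|exact: continuous_gauss_fun].
Qed.

Let sum_f_ge0 (f : J -> R) x : (forall i, 0 <= f i) -> 0 <= \sum_i f i * hat (x - pos i).
Proof. by move=> f0; apply: sumr_ge0 => i _; rewrite mulr_ge0 ?hat_ge0. Qed.

Let phi_gt0 f e x : (forall i, 0 <= f i) -> 0 < e -> 0 < phi f e x.
Proof.
move=> f0 e0; apply: ltr_wpDl; first exact: sum_f_ge0.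
by rewrite mulr_gt0// expR_gt0.
Qed.

Let phi_mass f e : (forall i, 0 <= f i) -> 0 < e ->
  (\int[mu]_x (phi f e x)%:E = (B * (\sum_i f i) + e * Num.sqrt pi)%:E)%E.
Proof.
move=> f0 e0; rewrite /phi.
under eq_integral do rewrite EFinD -sumEFin.
have mh i : measurable_fun setT (fun x : R => hat (x - pos i)).
  by apply: measurableT_comp => //; apply: measurable_funB.
have mfh i : measurable_fun setT (fun x : R => f i * hat (x - pos i)).
  by apply: measurable_funM.
rewrite ge0_integralD//; last 4 first.
- by move=> x _; apply: sume_ge0 => i _; rewrite lee_fin mulr_ge0 ?hat_ge0.
- by apply: emeasurable_sum => i; apply/measurable_EFinP; exact: mfh.
- by move=> x _; rewrite lee_fin; apply: mulr_ge0; [exact: ltW|exact: gauss_fun_ge0].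
- by apply/measurable_EFinP; apply: measurable_funM => //; exact: measurable_gauss_fun.
rewrite ge0_integral_sum//; last 2 first.
- by move=> i; apply/measurable_EFinP; exact: mfh.
- by move=> i x _; rewrite lee_fin mulr_ge0 ?hat_ge0.
rewrite ge0_integralTZl; [|exact: measurable_gauss_fun|exact: gauss_fun_ge0|exact: ltW].
rewrite integralT_gauss -EFinM EFinD; congr (_ + _)%E.
rewrite mulr_sumr -sumEFin; apply: eq_bigr => i _.
rewrite ge0_integralTZl//; last by move=> x; exact: hat_ge0.
by rewrite integral_hat_shift -EFinM mulrC.
Qed.

Let phi_pow23 f e x : (forall i, 0 <= f i) -> 0 < e ->
  \sum_i hat (x - pos i) * pow23 (f i) <= pow23 (phi f e x).
Proof.
move=> f0 e0.
apply: (@le_trans _ _ (pow23 (\sum_i hat (x - pos i) * f i))).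
  apply: pow23_concave => //; first by move=> i; exact: hat_ge0.
  exact: sum_hat_le1.
apply: le_pow23; first by apply: sumr_ge0 => i _; rewrite mulr_ge0 ?hat_ge0.
rewrite /phi; under eq_bigr do rewrite mulrC.
by rewrite lerDl mulr_ge0 ?gauss_fun_ge0// ltW.
Qed.

(** The weight is the integral of [hat (x - i) * hat (y - j) * hat (x - y - k)], normalized by the
    square of the tent mass. By concavity of [pow23], the tent averages of the values [pow23 (f i)]
    are below [pow23] of the interpolation; applied at [x], [y] and [x - y], this bounds the sum by
    the integral in Young's inequality. *)
Lemma discrete_young : exists w : J -> J -> J -> R, [/\
  forall i j k, 0 <= w i j k,
  forall i j k, 3 <= `|pos k - (pos i - pos j)| -> w i j k = 0,
  forall i j, `|pos i| + `|pos j| + 2 <= M%:R -> \sum_k w i j k = 1 &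
  young_kernel w (Num.sqrt 3 / 2)].
Proof.
have B0 : 0 < B by exact: hat_mass_gt0.
exists (fun i j k => W i j k / B ^+ 2); split.
- by move=> i j k; rewrite divr_ge0// exprn_ge0// ltW.
- by move=> i j k H; rewrite W_eq0// mul0r.
- by move=> i j H; rewrite -mulr_suml W_sum// divff// expf_eq0/= gt_eqF.
move=> f g h f0 g0 h0.
set F := \sum_i f i; set G := \sum_i g i; set H := \sum_i h i.
have F0 : 0 <= F by apply: sumr_ge0.
have G0 : 0 <= G by apply: sumr_ge0.
have H0 : 0 <= H by apply: sumr_ge0.
set X := \sum_i \sum_j \sum_k W i j k * pow23 (f i * g j * h k).
have -> : \sum_i \sum_j \sum_k W i j k / B ^+ 2 * pow23 (f i * g j * h k) = X / B ^+ 2.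
  rewrite /X mulr_suml; apply: eq_bigr => i _; rewrite mulr_suml; apply: eq_bigr => j _.
  by rewrite mulr_suml; apply: eq_bigr => k _; rewrite mulrAC.
have fgh0 i j k : 0 <= f i * g j * h k by rewrite !mulr_ge0.
have X0 : 0 <= X.
  by do 3 (apply: sumr_ge0 => ? _); rewrite mulr_ge0 ?pow23_ge0.
rewrite ler_pdivrMr ?exprn_gt0//.
(* The interpolations have masses [B] times the sums, up to the perturbation, and
   [pow23 (B ^+ 3) = B ^+ 2] absorbs the normalization exactly. *)
have -> : c * pow23 (F * G * H) * B ^+ 2 = c * pow23 (B * F * (B * G) * (B * H)).
  have -> : B ^+ 2 = pow23 (B ^+ 3).
    apply: (@pexpIrn _ 3) => //; rewrite ?nnegrE ?pow23_ge0 ?exprn_ge0 ?(ltW B0)//.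
    by rewrite pow23_cube ?exprn_ge0 ?(ltW B0)// exprAC.
  rewrite -mulrA -pow23M ?mulr_ge0 ?exprn_ge0 ?(ltW B0)//.
  by congr (_ * pow23 _); ring.
apply: (@le_pow23_lim _ _ _ _ _ (Num.sqrt pi)); rewrite ?mulr_ge0 ?(ltW B0) ?sqrtr_ge0//.
move=> e e0; rewrite -lee_fin.
have pg (k : J -> R) : (forall i, 0 <= k i) -> 0 < B * (\sum_i k i) + e * Num.sqrt pi.
  move=> k0; apply: ltr_wpDl; first by rewrite mulr_ge0 ?(ltW B0)// sumr_ge0.
  by rewrite mulr_gt0// sqrtr_gt0 pi_gt0.
apply: le_trans (@young_2_3 R (phi f e) (phi g e) (phi h e) _ _ _
  (@phi_cont f e) (@phi_cont g e) (@phi_cont h e)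
  (fun x => @phi_gt0 f e x f0 e0) (fun x => @phi_gt0 g e x g0 e0) (fun x => ltW (@phi_gt0 h e x h0 e0))
  (phi_mass f0 e0) (phi_mass g0 e0) (phi_mass h0 e0) (pg _ f0) (pg _ g0) (pg _ h0)).
have -> : X%:E = integral2 (fun x y => \sum_i \sum_j \sum_k pow23 (f i * g j * h k) * T i j k x y).
  have mS3 i j k : measurable2 (fun x y => pow23 (f i * g j * h k) * T i j k x y).
    by apply: measurable2M => //; apply: (measurable2_fst (k := cst _)).
  have S0 i j k x y : 0 <= pow23 (f i * g j * h k) * T i j k x y.
    by rewrite mulr_ge0 ?pow23_ge0.
  rewrite integral2_sum; last 2 first.
  - by move=> i; do 2 (apply: measurable2_sum => ?).
  - by move=> i x y; do 2 (apply: sumr_ge0 => ? _).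
  rewrite /X -sumEFin; apply: eq_bigr => i _.
  rewrite integral2_sum; last 2 first.
  - by move=> j; apply: measurable2_sum => ?.
  - by move=> j x y; apply: sumr_ge0 => ? _.
  rewrite -sumEFin; apply: eq_bigr => j _.
  rewrite integral2_sum// -sumEFin; apply: eq_bigr => k _.
  by rewrite integral2Z ?pow23_ge0// WE -EFinM mulrC.
have mphi (k : J -> R) : measurable_fun setT (phi k e).
  exact: continuous_measurable_fun.
apply: integral2_le.
- do 3 (apply: measurable2_sum => ?).
  by apply: measurable2M => //; apply: (measurable2_fst (k := cst _)).
- apply: measurable2_comp; first exact: measurable_pow23.
  apply: measurable2M.
    by apply: measurable2M; [exact: measurable2_fst|exact: measurable2_snd].
  apply: measurable2_comp => //.
  by apply: measurable2B; [apply: (measurable2_fst (k := id))|apply: (measurable2_snd (k := id))].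
- by move=> x y; do 3 (apply: sumr_ge0 => ? _); rewrite mulr_ge0 ?pow23_ge0.
move=> x y.
have phi0 (k : J -> R) z : (forall i, 0 <= k i) -> 0 <= phi k e z by move=> k0; exact/ltW/phi_gt0.
rewrite !pow23M ?mulr_ge0 ?phi0//.
have S0 (k : J -> R) z : (forall i, 0 <= k i) -> 0 <= \sum_i hat (z - pos i) * pow23 (k i).
  by move=> k0; apply: sumr_ge0 => i _; rewrite mulr_ge0 ?hat_ge0 ?pow23_ge0.
apply: (@le_trans _ _ ((\sum_i hat (x - pos i) * pow23 (f i)) *
   (\sum_j hat (y - pos j) * pow23 (g j)) * (\sum_k hat (x - y - pos k) * pow23 (h k)))); last first.
  by rewrite ler_pM ?mulr_ge0 ?S0 ?phi_pow23// ler_pM ?S0 ?phi_pow23.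
rewrite -mulrA mulr_suml; apply: ler_sum => i _.
rewrite mulr_suml mulr_sumr; apply: ler_sum => j _.
rewrite mulr_sumr mulr_sumr; apply: ler_sum => k _.
rewrite !pow23M ?mulr_ge0// le_eqVlt; apply/orP; left; apply/eqP.
by rewrite /T; ring.
Qed.

End Kernel.
End YoungKernel.

(** * Tensor powers of a Young kernel *)

Section Tensor.
Context {R : realType}.

Lemma big_prod2 (I1 I2 : finType) (F : I1 * I2 -> R) :
  \sum_x F x = \sum_x2 \sum_x1 F (x1, x2).
Proof.
rewrite exchange_big pair_bigA /=; by apply: eq_bigr => -[].
Qed.

(** Freeze the second coordinates and apply the first inequality to the slices; what comes out is
    the second inequality for the marginals [F], [G], [H]. *)
Lemma young_kernel_prod (I1 I2 : finType) (w1 : I1 -> I1 -> I1 -> R) (w2 : I2 -> I2 -> I2 -> R) c1 c2 :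
  0 <= c1 -> (forall i j k, 0 <= w2 i j k) -> young_kernel w1 c1 -> young_kernel w2 c2 ->
  young_kernel (fun x y z : I1 * I2 => w1 x.1 y.1 z.1 * w2 x.2 y.2 z.2) (c1 * c2).
Proof.
move=> c10 w20 Y1 Y2 f g h f0 g0 h0.
pose F x2 := \sum_x1 f (x1, x2).
pose G x2 := \sum_x1 g (x1, x2).
pose H x2 := \sum_x1 h (x1, x2).
rewrite !(big_prod2 f) !(big_prod2 g) !(big_prod2 h) -/F -/G -/H.
have -> : \sum_x \sum_y \sum_z w1 x.1 y.1 z.1 * w2 x.2 y.2 z.2 * pow23 (f x * g y * h z) =
  \sum_x2 \sum_y2 \sum_z2 w2 x2 y2 z2 *
    \sum_x1 \sum_y1 \sum_z1 w1 x1 y1 z1 * pow23 (f (x1, x2) * g (y1, y2) * h (z1, z2)).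
  rewrite big_prod2; apply: eq_bigr => x2 _.
  under eq_bigr do rewrite big_prod2.
  rewrite exchange_big; apply: eq_bigr => y2 _ /=.
  under eq_bigr do under eq_bigr do rewrite big_prod2.
  under eq_bigr do rewrite exchange_big.
  rewrite exchange_big; apply: eq_bigr => z2 _ /=.
  rewrite mulr_sumr; apply: eq_bigr => x1 _; rewrite mulr_sumr; apply: eq_bigr => y1 _.
  rewrite mulr_sumr; apply: eq_bigr => z1 _; ring.
apply: (@le_trans _ _ (c1 * \sum_x2 \sum_y2 \sum_z2 w2 x2 y2 z2 * pow23 (F x2 * G y2 * H z2))).
  rewrite mulr_sumr; apply: ler_sum => x2 _; rewrite mulr_sumr; apply: ler_sum => y2 _.
  rewrite mulr_sumr; apply: ler_sum => z2 _; rewrite mulrCA ler_wpM2l//.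
  exact: (Y1 (fun x1 => f (x1, x2)) (fun x1 => g (x1, y2)) (fun x1 => h (x1, z2))).
rewrite -[leRHS]mulrA ler_wpM2l//.
by apply: Y2 => ?; apply: sumr_ge0.
Qed.

Lemma young_kernel_bij (I1 I2 : finType) (phi : I1 -> I2)
    (w1 : I1 -> I1 -> I1 -> R) w2 c : bijective phi ->
  (forall x y z, w2 (phi x) (phi y) (phi z) = w1 x y z) ->
  young_kernel w1 c -> young_kernel w2 c.
Proof.
move=> bphi wE Y f g h f0 g0 h0.
have re (F : I2 -> R) : \sum_x F x = \sum_x F (phi x).
  by rewrite (reindex phi)//; exact: onW_bij.
have := Y (f \o phi) (g \o phi) (h \o phi) (fun=> f0 _) (fun=> g0 _) (fun=> h0 _).
rewrite (re f) (re g) (re h) /= => /(le_trans _); apply.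
rewrite le_eqVlt; apply/orP; left; apply/eqP.
rewrite re; apply: eq_bigr => x _; rewrite re; apply: eq_bigr => y _.
by rewrite re; apply: eq_bigr => z _; rewrite wE.
Qed.

Definition ffun_cons (I : finType) d (p : I * {ffun 'I_d -> I}) : {ffun 'I_d.+1 -> I} :=
  [ffun i => oapp p.2 p.1 (unlift ord0 i)].

Lemma ffun_cons_bij (I : finType) d : bijective (@ffun_cons I d).
Proof.
exists (fun x : {ffun 'I_d.+1 -> I} => (x ord0, [ffun i => x (lift ord0 i)])) => [[a x]|x].
  rewrite /ffun_cons ffunE unlift_none /=; congr (_, _).
  by apply/ffunP => i; rewrite !ffunE liftK.
apply/ffunP => i; rewrite ffunE.
by case: unliftP => [j|] -> /=; rewrite ?ffunE.
Qed.

Lemma young_kernel_tensor (I : finType) (w : I -> I -> I -> R) c d : 0 <= c ->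
  (forall i j k, 0 <= w i j k) -> young_kernel w c ->
  young_kernel (fun x y z : {ffun 'I_d -> I} => \prod_l w (x l) (y l) (z l)) (c ^+ d).
Proof.
move=> c0 w0 Y; elim: d => [|d IH].
  move=> f g h f0 g0 h0.
  have u (F : {ffun 'I_0 -> I} -> R) : \sum_x F x = F (ffun0 (card_ord 0)).
    rewrite (bigD1 (ffun0 (card_ord 0)))//= big1 ?addr0// => x /eqP[].
    by apply/ffunP => -[].
  by rewrite !u big_ord0 expr0 mul1r.
rewrite exprS; apply: (young_kernel_bij (ffun_cons_bij I d)); last first.
  exact: (young_kernel_prod c0 (fun x y z => prodr_ge0 _ (fun l _ => w0 _ _ _)) Y IH).
move=> [x1 x] [y1 y] [z1 z]; rewrite big_ord_recl !ffunE unlift_none /=; congr (_ * _).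
by apply: eq_bigr => l _; rewrite !ffunE !liftK.
Qed.

End Tensor.

(** * Combinatorics of lattice points *)

(** A Turan-type bound for a possibly asymmetric relation with [N] related pairs. The symmetrized
    neighborhoods have total size at most [2 N], so at least half of [A] has degree at most
    [4 N / #|A|]. A maximal independent set among these low-degree points has neighborhoods covering
    all of them. *)
Lemma independent_set (T : finType) (A : {set T}) (e : rel T) :
  {in A, reflexive e} -> exists I : {set T}, [/\ I \subset A,
    {in I &, forall x y, x != y -> ~~ e x y} &
    (#|A| ^ 2 <= 8 * #|[set xy | [&& xy.1 \in A, xy.2 \in A & e xy.1 xy.2]]| * #|I|)%N].
Proof.
move=> e_refl; set N := #|[set xy | _]|.
pose nb x := [set y in A | e x y || e y x].
pose L := [set x in A | #|nb x| * #|A| <= 4 * N]%N.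
have sum_nb : (\sum_(x in A) #|nb x| <= 2 * N)%N.
  have sN (F : rel T) : \sum_(x in A) #|[set y in A | F x y]| =
      #|[set xy | [&& xy.1 \in A, xy.2 \in A & F xy.1 xy.2]]| :> nat.
    under eq_bigr do rewrite -sum1_card.
    rewrite -sum1_card pair_big_dep/=; apply: eq_bigl => -[x y] /=.
    by rewrite !inE /=; case: (x \in A); case: (y \in A).
  have N' : #|[set xy | [&& xy.1 \in A, xy.2 \in A & e xy.2 xy.1]]| = N.
    pose sw (xy : T * T) := (xy.2, xy.1).
    have swI : injective sw by move=> [a b] [c d] [-> ->].
    rewrite /N -(card_imset _ swI); apply: eq_card => -[x y].
    apply/imsetP/idP => [[[x' y']]|].
      by rewrite !inE /sw/= => /and3P[? ? ?] [-> ->]; apply/and3P.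
    rewrite !inE/= => /and3P[? ? ?]; exists (y, x) => //; rewrite !inE/=.
    exact/and3P.
  rewrite mul2n -addnn -{2}N' /N -(sN e) -(sN (fun x y => e y x)) -big_split/=.
  apply: leq_sum => x _.
  have -> : nb x = [set y in A | e x y] :|: [set y in A | e y x].
    by apply/setP => y; rewrite !inE -andb_orr.
  exact: leq_card_setU.
have L_half : (#|A| <= 2 * #|L|)%N.
  rewrite leqNgt; apply/negP => H.
  have N0 : (0 < N)%N.
    have /card_gt0P[x xA] : (0 < #|A|)%N by exact: leq_ltn_trans H.
    by apply/card_gt0P; exists (x, x); rewrite !inE/= xA e_refl.
  have LA : L \subset A by apply/fintype.subsetP => x; rewrite inE => /andP[].
  have : (#|A :\: L| * (4 * N) <= 2 * N * #|A|)%N.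
    apply: (@leq_trans (\sum_(x in A :\: L) #|nb x| * #|A|)).
      rewrite -sum_nat_const; apply: leq_sum => x.
      by rewrite !inE => /andP[+ xA]; rewrite xA -ltnNge => /ltnW.
    rewrite -big_distrl leq_mul2r; apply/orP; right.
    apply: leq_trans sum_nb.
    by rewrite [leqRHS](big_setID L)/= (finset.setIidPr LA) leq_addl.
  have := cardsDS LA; have := subset_leq_card LA; nia.
pose indep (I : {set T}) := (I \subset L) && [forall x in I, forall y in I, (x != y) ==> ~~ e x y].
have [I maxI] : {I | maxset indep I}.
  apply: ex_maxset; exists finset.set0; rewrite /indep finset.sub0set /=.
  by apply/forall_inP => x; rewrite inE.
have /maxsetP[/andP[IL /forall_inP indI] max] := maxI.
have LA : L \subset A by apply/fintype.subsetP => x; rewrite inE => /andP[].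
exists I; split.
- exact: fintype.subset_trans IL LA.
- by move=> x y xI yI; apply/implyP; move: (indI x xI) => /forall_inP; apply.
have cov : L \subset \bigcup_(x in I) nb x.
  apply/fintype.subsetP => y yL; apply/bigcupP.
  have yA : y \in A by apply: (fintype.subsetP LA).
  have [yI|yI] := boolP (y \in I).
    by exists y => //; rewrite inE yA e_refl.
  have [/exists_inP[x xI xy]|] := boolP [exists x in I, e x y || e y x].
    by exists x => //; rewrite inE yA.
  rewrite negb_exists_in => /forall_inP H.
  have : indep (y |: I).
    apply/andP; split; first by rewrite finset.subUset finset.sub1set yL.
    apply/forall_inP => u /finset.setU1P[->|uI]; apply/forall_inP => v /finset.setU1P[->|vI]; apply/implyP.
    - by rewrite eqxx.
    - by move=> _; have := H v vI; rewrite negb_or => /andP[].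
    - by move=> _; have := H u uI; rewrite negb_or => /andP[].
    - by move: (indI u uI) => /forall_inP/(_ v vI)/implyP.
  move=> /max/(_ (finset.subsetUr _ _)) E.
  by case/negP: yI; rewrite -E finset.setU11.
have LI : (#|L| * #|A| <= 4 * N * #|I|)%N.
  apply: (@leq_trans (\sum_(x in I) #|nb x| * #|A|)).
    rewrite -big_distrl leq_mul2r; apply/orP; right.
    apply: leq_trans (subset_leq_card cov) _.
    elim/big_rec2: _ => [|x m S _ H]; first by rewrite cards0.
    by apply: leq_trans (leq_card_setU _ _) _; rewrite leq_add2l.
  rewrite mulnC -sum_nat_const; apply: leq_sum => x xI.
  by have := fintype.subsetP IL x xI; rewrite inE => /andP[].
nia.
Qed.

(** * A scale at which a sequence comparable to the powers of 2 grows regularly *)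

Section Growth.
Context {R : realType}.

Lemma exprn_unbounded (q c : R) : 1 < q -> exists n : nat, c < q ^+ n.
Proof.
move=> q1; have q0 : 0 < q - 1 by rewrite subr_gt0.
exists (Num.bound (`|c| / (q - 1))).
set n := Num.bound _.
have Hn : `|c| / (q - 1) < n%:R by apply: archi_boundP; rewrite divr_ge0 ?(ltW q0).
apply: (@lt_le_trans _ _ (n%:R * (q - 1) + 1)).
  by rewrite (le_lt_trans (ler_norm c))// ltr_wpDr// -ltr_pdivrMr.
elim: n {Hn} => [|n IH]; first by rewrite mul0r add0r expr0.
rewrite exprS; apply: (@le_trans _ _ (q * (n%:R * (q - 1) + 1))).
  rewrite -subr_ge0 -natr1.
  have -> : q * (n%:R * (q - 1) + 1) - ((n%:R + 1) * (q - 1) + 1) = n%:R * (q - 1) ^+ 2 by ring.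
  by rewrite mulr_ge0 ?sqr_ge0.
by rewrite ler_pM2l// (lt_trans _ q1).
Qed.

(* The index sought maximizes [b k / 4 ^ k] among the [k] with [b k >= 3/2 b (k - 1)]. *)
Lemma growth_window (c1 c2 : R) : 0 < c1 -> exists N : nat, forall b : nat -> R,
  (forall k, (k <= N)%N -> c1 * 2 ^+ k <= b k <= c2 * 2 ^+ k) ->
  exists k, [/\ (k.+3 <= N)%N, 3 / 2 * b k <= b k.+1 & b k.+3 <= 16 * b k.+1].
Proof.
move=> c10.
(* The ratio [4 / 3] is 2 over [3 / 2]: growth by less than [3 / 2] in each of the first [n1] steps
   would contradict the lower bound at [n1]. The role of [n2] is to keep the maximizer away from the
   end of the range. *)
have [n1 Hn1] : exists n, c2 / c1 < (4 / 3 : R) ^+ n by apply: exprn_unbounded; lra.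
have [n2 Hn2] : exists n, c2 * 4 ^+ n1 / c1 < (2 : R) ^+ n by apply: exprn_unbounded; lra.
exists (n1 + n2).+2 => b Hb.
set N := (n1 + n2).+2 in Hb *.
have b0 k : (k <= N)%N -> 0 < b k.
  by move=> /Hb/andP[+ _]; apply: lt_le_trans; rewrite mulr_gt0// exprn_gt0.
pose P (i : 'I_N.+1) := (0 < i)%N && (3 / 2 * b i.-1 <= b i).
have [k1 Pk1 k1n] : exists2 k1, P k1 & (k1 <= n1)%N.
  apply: contrapT => H.
  have step k : (k < n1)%N -> b k.+1 <= 3 / 2 * b k.
    move=> kn; rewrite leNgt; apply/negP => /ltW Hk; apply: H.
    have kN : (k.+1 < N.+1)%N by rewrite /N; lia.
    by exists (Ordinal kN).
  have all k : (k <= n1)%N -> b k <= (3 / 2) ^+ k * b 0.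
    elim: k => [|k IH] kn; first by rewrite mul1r.
    by rewrite (le_trans (step _ kn))// exprS -[leRHS]mulrA ler_pM2l// IH// ltnW.
  have := all _ (leqnn n1); rewrite leNgt => /negP; apply.
  have /andP[Hl _] := Hb n1 ltac:(rewrite /N; lia).
  have /andP[_ Hu] := Hb 0%N isT.
  rewrite expr0 mulr1 in Hu.
  have c2n : c2 < c1 * (4 / 3) ^+ n1 by rewrite mulrC -ltr_pdivrMr.
  apply: lt_le_trans Hl.
  have -> : c1 * 2 ^+ n1 = (3 / 2) ^+ n1 * (c1 * (4 / 3) ^+ n1).
    rewrite mulrCA -exprMn; congr (_ * _ ^+ _); by field.
  by rewrite ltr_pM2l ?exprn_gt0// (le_lt_trans Hu).
pose w (i : 'I_N.+1) := b i / 4 ^+ i.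
case: (@Order.TotalTheory.arg_maxP _ _ _ k1 P w Pk1) => k /andP[k0 Gk] maxk.
(* The quotient [b k / 4 ^ k] is at most [c2 / 2 ^ k]; near the end of the range this is below the
   quotient at [k1], which is at least [c1 / 4 ^ n1]. *)
have kN3 : (k.+2 <= N)%N.
  rewrite leqNgt; apply/negP => kN.
  have : w k1 <= w k by exact: maxk.
  rewrite leNgt => /negP; apply; rewrite /w.
  have kN' : (k <= N)%N by rewrite -ltnS.
  have /andP[_ Hu] := Hb k kN'.
  have k1N : (k1 <= N)%N by rewrite -ltnS.
  have /andP[Hl _] := Hb k1 k1N.
  apply: (@le_lt_trans _ _ (c2 / 2 ^+ k)).
    rewrite ler_pdivrMr ?exprn_gt0// (le_trans Hu)//.
    have -> : c2 / 2 ^+ k * 4 ^+ k = c2 * (4 ^+ k / 2 ^+ k) by rewrite mulrAC mulrA.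
    by rewrite -expr_div_n (_ : 4 / 2 = 2 :> R)//; field.
  apply: (@lt_le_trans _ _ (c1 / 4 ^+ n1)).
    rewrite ltr_pdivrMr ?exprn_gt0// mulrAC ltr_pdivlMr ?exprn_gt0//.
    rewrite -ltr_pdivrMl// mulrC (lt_le_trans Hn2)// ler_eXn2l ?ltr1n//.
    by move: kN; rewrite /N; lia.
  rewrite ler_pdivlMr ?exprn_gt0// (le_trans _ Hl)//.
  rewrite -mulrA ler_pM2l// mulrC.
  rewrite (@le_trans _ _ 1)//; last by rewrite exprn_ege1// ler1n.
  by rewrite ler_pdivrMr ?exprn_gt0// mul1r ler_eXn2l// ?ltr1n.
(* Either the next index satisfies the growth condition and maximality of [k] applies to it, or the
   step multiplies by less than [3 / 2], hence by less than 4. *)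
have step j : (k + j.+1 <= N)%N -> b (k + j)%N <= 4 ^+ j * b k ->
    b (k + j.+1)%N <= 4 ^+ j.+1 * b k.
  move=> kjN IH.
  have [Gj|Gj] := leP (3 / 2 * b (k + j)%N) (b (k + j.+1)%N).
    have kjN1 : (k + j.+1 < N.+1)%N by [].
    have : w (Ordinal kjN1) <= w k.
      by apply: maxk; rewrite /P /= addnS /= -addnS Gj.
    rewrite /w /=.
    rewrite exprD ler_pdivrMr ?mulr_gt0 ?exprn_gt0// => /le_trans; apply.
    rewrite mulrA divfK; first by rewrite mulrC.
    by rewrite expf_eq0 pnatr_eq0 andbF.
  rewrite (le_trans (ltW Gj))// exprS -[leRHS]mulrA.
  apply: (@le_trans _ _ (3 / 2 * (4 ^+ j * b k))); first by rewrite ler_pM2l.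
  rewrite ler_wpM2r//; last by lra.
  by rewrite mulr_ge0 ?exprn_ge0// ltW// b0// -ltnS.
exists k.-1; rewrite prednK//; split => //.
have s1 : b (k + 1)%N <= 4 ^+ 1 * b k.
  by apply: step; [lia|rewrite addn0 mul1r].
have := step 1%N ltac:(lia) s1.
by rewrite addn2 (_ : 4 ^+ 2 = 16 :> R)//; ring.
Qed.

End Growth.

(** * Counting lattice points in a box *)

Section Box.
Context {R : realType}.
Variables (d M : nat).
Local Notation box := {ffun 'I_d -> 'I_(2 * M).+1}.

Definition centered (i : 'I_(2 * M).+1) : R := i%:R - M%:R.

Lemma centered_le (i : 'I_(2 * M).+1) (n : nat) :
  (`|centered i| <= n%:R) = (M <= i + n)%N && (i <= M + n)%N.
Proof.
rewrite /centered ler_norml lerBrDr [- _ + _]addrC !lerBlDr -!natrD !ler_nat.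
by rewrite [(n + M)%N]addnC.
Qed.

Lemma centered_trunc (i : 'I_(2 * M).+1) (S : R) : 0 <= S ->
  (`|centered i| <= S) = (`|centered i| <= (Num.truncn S)%:R).
Proof.
move=> S0.
have [m ->] : exists m : nat, `|centered i| = m%:R.
  rewrite /centered; have [Mi|/ltnW iM] := leqP M i.
    by exists (i - M)%N; rewrite -natrB// ger0_norm.
  by exists (M - i)%N; rewrite distrC -natrB// ger0_norm.
by rewrite ler_nat truncn_ge_nat.
Qed.

Lemma card_centered_le (S : R) : 0 <= S ->
  #|[pred i | `|centered i| <= S]|%:R <= 2 * S + 1.
Proof.
move=> S0; set n := Num.truncn S.
apply: (@le_trans _ _ (2 * n).+1%:R); last first.
  rewrite -natr1 natrM lerD2r ler_pM2l//.
  by rewrite /n truncn_le.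
rewrite ler_nat cardE -(size_map val) -(size_iota (M - n) (2 * n).+1).
apply: uniq_leq_size.
  by rewrite map_inj_uniq ?enum_uniq//; exact: val_inj.
move=> j /mapP[i]; rewrite mem_enum inE centered_trunc// centered_le -/n => /andP[? ?] ->.
by rewrite mem_iota /=; lia.
Qed.

Lemma card_centered_ge (S : R) : 0 <= S -> S <= M%:R ->
  S <= #|[pred i | `|centered i| <= S]|%:R.
Proof.
move=> S0 SM; set n := Num.truncn S.
have nM : (n <= M)%N.
  by rewrite -(ler_nat R) (le_trans _ SM)// truncn_le.
apply: (@le_trans _ _ n.+1%:R).
  by rewrite ltW// truncnS_gt.
rewrite ler_nat cardE -(size_map val) -(size_iota M n.+1).
apply: uniq_leq_size; first exact: iota_uniq.
move=> j; rewrite mem_iota => /andP[? ?].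
have jM : (j < (2 * M).+1)%N by lia.
apply/mapP; exists (Ordinal jM) => //.
by rewrite mem_enum inE centered_trunc// centered_le -/n /=; lia.
Qed.

Lemma card_box_le (S : R) (A : {set box}) : 0 <= S ->
  (forall x, x \in A -> forall l, `|centered (x l)| <= S) -> #|A|%:R <= (2 * S + 1) ^+ d.
Proof.
move=> S0 AS.
apply: (@le_trans _ _ (#|[pred i | `|centered i| <= S]|%:R ^+ d)); last first.
  by rewrite lerXn2r ?nnegrE ?card_centered_le ?addr_ge0 ?mulr_ge0.
rewrite -natrX ler_nat -[X in (_ ^ X)%N](card_ord d) -card_ffun_on.
apply/subset_leq_card/fintype.subsetP => x /AS xS.
by apply/ffun_onP => l; rewrite inE.
Qed.

Lemma card_box_ge (S : R) (A : {set box}) : 0 <= S -> S <= M%:R ->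
  (forall x : box, (forall l, `|centered (x l)| <= S) -> x \in A) -> S ^+ d <= #|A|%:R.
Proof.
move=> S0 SM AS.
apply: (@le_trans _ _ (#|[pred i | `|centered i| <= S]|%:R ^+ d)).
  by rewrite lerXn2r ?nnegrE// card_centered_ge.
rewrite -natrX ler_nat -[X in (_ ^ X)%N](card_ord d) -card_ffun_on.
apply/subset_leq_card/fintype.subsetP => x /ffun_onP xS.
by apply: AS => l; have := xS l; rewrite inE.
Qed.

(** The tensorized inequality for three copies of the indicator of [C]: its right side is the
    constant times [pow23 (#|C| ^ 3) = #|C| ^ 2]. Each pair of [E] contributes 1 on the left,
    because the kernel at that pair has total weight 1 and is supported on points [z] of [C]. *)
Lemma card_close_pairs (C : {set box}) (E : {set box * box}) :
  (forall xy, xy \in E -> [/\ xy.1 \in C, xy.2 \in C,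
     forall l, `|centered (xy.1 l)| + `|centered (xy.2 l)| + 2 <= M%:R &
     forall z : box, (forall l, `|centered (z l) - (centered (xy.1 l) - centered (xy.2 l))| < 3) ->
       z \in C]) ->
  #|E|%:R <= (Num.sqrt 3 / 2) ^+ d * #|C|%:R ^+ 2 :> R.
Proof.
move=> HE.
have [w [w0 w_far w_sum Yw]] := @discrete_young R M.
have c0 : 0 <= Num.sqrt 3 / 2 :> R by rewrite divr_ge0 ?sqrtr_ge0.
pose f (x : box) : R := (x \in C)%:R.
have f0 x : 0 <= f x by rewrite /f.
have := @young_kernel_tensor R _ w _ d c0 w0 Yw f f f f0 f0 f0.
have sf : \sum_x f x = #|C|%:R.
  by rewrite -sum1_card natr_sum [RHS]big_mkcond; apply: eq_bigr => x _; rewrite /f; case: ifP.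
rewrite sf; set n : R := #|C|%:R.
have -> : pow23 (n * n * n) = n ^+ 2.
  apply: (@pexpIrn _ 3) => //; rewrite ?nnegrE ?pow23_ge0 ?exprn_ge0//.
  by rewrite pow23_cube ?mulr_ge0// exprAC; congr (_ ^+ _); ring.
apply: le_trans.
rewrite pair_bigA /=.
have term0 (x y z : box) : 0 <= \prod_l w (x l) (y l) (z l) * pow23 (f x * f y * f z).
  by rewrite mulr_ge0 ?pow23_ge0// prodr_ge0.
rewrite (bigID (mem E)) /= ler_wpDr//.
  by apply: sumr_ge0 => xy _; apply: sumr_ge0.
rewrite -sum1_card natr_sum; apply: ler_sum => -[x y] /HE[/= xC yC xyM xyz].
have -> : \sum_(z : box) \prod_l w (x l) (y l) (z l) * pow23 (f x * f y * f z) =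
    \sum_(z : box) \prod_l w (x l) (y l) (z l).
  apply: eq_bigr => z _; rewrite /f xC yC !mul1r.
  have [zC|zC] := boolP (z \in C); first by rewrite pow23_1 mulr1.
  suff -> : \prod_l w (x l) (y l) (z l) = 0 by rewrite mul0r.
  have [l lz] : exists l, 3 <= `|centered (z l) - (centered (x l) - centered (y l))|.
    apply: contrapT => H; case/negP: zC; apply: xyz => l.
    by rewrite ltNge; apply/negP => ?; apply: H; exists l.
  by rewrite (bigD1 l)//= w_far// mul0r.
(* The sum over [z] of products is the product over coordinates of the one-dimensional sums, each
   equal to 1. *)
rewrite -(bigA_distr_bigA (fun l k => w (x l) (y l) k)).
by rewrite big1// => l _; exact: w_sum (xyM l).
Qed.

End Box.

(** * Separated points on the unit sphere of a sublinear functional *)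

Section Sublinear.
Context {R : realType}.

Lemma centered_floor (M : nat) (r : R) : `|r| <= M%:R ->
  exists i : 'I_(2 * M).+1, centered i <= r < centered i + 1.
Proof.
rewrite ler_norml => /andP[r1 r2].
have rM : 0 <= r + M%:R by rewrite -lerBlDr sub0r.
have /andP[h1 h2] := truncn_itv rM.
have nM : (Num.truncn (r + M%:R) < (2 * M).+1)%N.
  rewrite ltnS -(ler_nat R) (le_trans h1)// natrM; lra.
exists (Ordinal nM); rewrite /centered /= lerBlDr h1 /=.
by rewrite -natr1 in h2; lra.
Qed.

Lemma centered_inj_lt (M : nat) (i j : 'I_(2 * M).+1) :
  centered i - centered j < 1 :> R -> (i <= j)%N.
Proof.
rewrite /centered => h; rewrite -ltnS -(ltr_nat R) -natr1; lra.
Qed.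

Variables (d : nat) (g : 'rV[R]_d -> R) (rho S : R).
Hypotheses (d0 : (0 < d)%N) (rho0 : 0 < rho) (S0 : 0 < S).
Hypotheses (gZ : forall (c : R) (x : 'rV[R]_d), 0 <= c -> g (c *: x) = c * g x).
Hypotheses (gD : forall x y : 'rV[R]_d, g (x + y) <= g x + g y).
Hypotheses (g_up : forall (x : 'rV[R]_d) (e : R), (forall l, `|x 0 l| <= e) -> g x <= rho * e).
Hypotheses (g_low : forall (x : 'rV[R]_d) l, `|x 0 l| <= S * g x).

Let g00 : g 0 = 0. Proof. by rewrite -(scale0r 0) gZ// mul0r. Qed.

Section Shell.
Variables (M : nat) (q s : R).
Hypotheses (q1 : 1 < q) (s0 : 0 < s) (qs : 4 * rho <= (q - 1) * s).
Hypothesis sM : 2 * (S * (q ^+ 3 * s)) + 2 <= M%:R.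
Local Notation box := {ffun 'I_d -> 'I_(2 * M).+1}.

Let lat (x : box) : 'rV[R]_d := \row_l centered (x l).
Let A : {set box} := [set x | s < g (lat x) <= q * s].
Let C : {set box} := [set x | g (lat x) <= q ^+ 3 * s].
Let proj (x : box) : 'rV[R]_d := (g (lat x))^-1 *: lat x.
Let near_rel : rel box := fun x y => g (proj x - proj y) <= 1.
Let E : {set box * box} := [set xy | [&& xy.1 \in A, xy.2 \in A & near_rel xy.1 xy.2]].

Let q0 : 0 < q. Proof. exact: lt_trans q1. Qed.

(** Room for two errors in each coordinate: 1 for rounding [q x] to a lattice point and 3 for the
    range of the kernel. Together they cost at most [4 * rho] in [g]. *)
Let q23 : q ^+ 2 * s + 4 * rho <= q ^+ 3 * s.
Proof.
rewrite -lerBrDl (le_trans qs)//.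
have -> : q ^+ 3 * s - q ^+ 2 * s = q ^+ 2 * ((q - 1) * s) by ring.
rewrite ler_peMl ?mulr_ge0 ?(ltW s0) ?subr_ge0 ?(ltW q1)//.
by rewrite exprn_ege1// ltW.
Qed.

Let latE (x : box) l : lat x 0 l = centered (x l). Proof. by rewrite mxE. Qed.

Let lat_coord (x : box) l : x \in C -> `|centered (x l) : R| <= S * (q ^+ 3 * s).
Proof.
by rewrite inE => xC; rewrite -latE (le_trans (g_low _ _))// ler_pM2l.
Qed.

Let AC x : x \in A -> x \in C.
Proof.
rewrite !inE => /andP[_ xA]; rewrite (le_trans xA)// ler_pM2r//.
by rewrite -{1}(expr1 q) ler_weXn2l// ltW.
Qed.

Let AqM x l : x \in A -> `|q * centered (x l)| <= M%:R.
Proof.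
rewrite inE => /andP[_ xA].
rewrite normrM (gtr0_norm q0) -latE.
apply: (@le_trans _ _ (q * (S * (q * s)))).
  by rewrite ler_pM2l// (le_trans (g_low _ _))// ler_pM2l.
apply: le_trans sM.
have : 0 <= S * (q ^+ 3 * s) by rewrite !mulr_ge0 ?exprn_ge0// ltW.
have : q * (S * (q * s)) <= S * (q ^+ 3 * s).
  rewrite (_ : _ * _ = S * (q ^+ 2 * s)); last by ring.
  by rewrite ler_pM2l// ler_pM2r// ler_weXn2l// ltW.
by lra.
Qed.

(** The lattice point just below [q x] in each coordinate. The default [ord0] does not occur on [A],
    where [q x] stays inside the box. *)
Let up (x : box) : box :=
  [ffun l => odflt ord0 [pick i | centered i <= q * centered (x l) < centered i + 1]].

Let upP x l : x \in A ->
  centered (up x l) <= q * centered (x l) < centered (up x l) + 1.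
Proof.
move=> xA; rewrite /up ffunE; case: pickP => [i //|H].
have [i] := centered_floor (AqM l xA).
by rewrite H.
Qed.

(** Multiplication by [q > 1] keeps distinct integers more than 1 apart, so rounding down cannot
    merge them. *)
Let up_inj : {in A &, injective up}.
Proof.
move=> x y xA yA xy; apply/ffunP => l; apply/val_inj/eqP.
have /andP[h1 h2] := upP l xA; have /andP[h3 h4] := upP l yA.
rewrite xy in h1 h2.
have lt1 (u v : R) : q * u - q * v < 1 -> u - v < 1.
  rewrite -mulrBr => h; rewrite ltNge; apply/negP => uv.
  move: h; rewrite ltNge => /negP; apply.
  by rewrite (le_trans (ltW q1))// ler_peMr// ltW.
by rewrite eqn_leq !(@centered_inj_lt M) //; apply: lt1; lra.
Qed.

Let g_close (u v : 'rV[R]_d) e : (forall l, `|u 0 l - v 0 l| <= e) -> g u <= g v + rho * e.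
Proof.
move=> uv; rewrite -[u](subrK v) addrC (le_trans (gD _ _))// lerD2l g_up// => l.
by rewrite !mxE uv.
Qed.

Let g_up1 x : x \in A -> g (lat (up x)) <= q ^+ 2 * s + rho.
Proof.
move=> xA; apply: (@le_trans _ _ (g (q *: lat x) + rho * 1)).
  apply: g_close => l; rewrite !mxE.
  by have /andP[? ?] := upP l xA; rewrite ler_norml; apply/andP; split; lra.
rewrite mulr1 lerD2r gZ ?(ltW q0)// expr2 -mulrA ler_pM2l//.
by move: xA; rewrite inE => /andP[].
Qed.

(* [q * |x| > |y|], so [q x - y = |y| (p_x - p_y) + (q |x| - |y|) p_x]. *)
Let g_diff x y : x \in A -> y \in A -> near_rel x y -> g (q *: lat x - lat y) <= q ^+ 2 * s.
Proof.
rewrite !inE /near_rel /proj => /andP[x1 x2] /andP[y1 y2] xy.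
set a := g (lat x) in x1 x2 xy *; set b := g (lat y) in y1 y2 xy *.
have a0 : 0 < a by exact: lt_trans x1.
have b0 : 0 < b by exact: lt_trans y1.
have qab : b <= q * a by rewrite (le_trans y2)// ler_pM2l// ltW.
have -> : q *: lat x - lat y =
    b *: (a^-1 *: lat x - b^-1 *: lat y) + (q * a - b) *: (a^-1 *: lat x).
  rewrite scalerBr !scalerA mulrBl scalerBl divff ?gt_eqF// scale1r mulfK ?gt_eqF//.
  by rewrite [RHS]addrAC [X in _ = X - _]addrC subrK.
rewrite (le_trans (gD _ _))// !gZ ?subr_ge0 ?invr_ge0 ?(ltW a0) ?(ltW b0)//.
rewrite -/a mulVf ?gt_eqF// mulr1.
have : b * g (a^-1 *: lat x - b^-1 *: lat y) <= b by rewrite ger_pMr.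
have : q * a <= q * (q * s) by rewrite ler_pM2l.
have -> : q * (q * s) = q ^+ 2 * s by ring.
by lra.
Qed.

(** Replacing [(x, y)] by [(up x, y)] loses no pair. By [g_diff] and [q23], every lattice point
    within 3 of [up x - y] lies in [C], so [card_close_pairs] applies to the image. *)
Let card_E : #|E|%:R <= (Num.sqrt 3 / 2) ^+ d * #|C|%:R ^+ 2 :> R.
Proof.
pose f (xy : box * box) := (up xy.1, xy.2).
have <- : #|f @: E| = #|E|.
  apply: card_in_imset => -[x y] [x' y']; rewrite inE /= => /and3P[xA yA _].
  by rewrite inE /= => /and3P[xA' yA' _] [/up_inj -> // ->].
apply: card_close_pairs => xy' /imsetP[[x y]].
rewrite inE /= => /and3P[xA yA xy] ->; rewrite /f /=.
have uC : up x \in C.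
  by rewrite inE (le_trans (g_up1 xA))// (le_trans _ q23)// lerD2l ler_peMl ?ler1n// ltW.
have yC := AC yA.
split => //.
- move=> l; apply: le_trans sM; rewrite lerD2r mulr_natl mulr2n.
  by rewrite lerD ?lat_coord.
- move=> z zl; rewrite inE; apply: le_trans q23.
  apply: (@le_trans _ _ (g (q *: lat x - lat y) + rho * 4)).
    apply: g_close => l; rewrite !mxE.
    have := zl l; have /andP[? ?] := upP l xA.
    rewrite ltr_norml => /andP[? ?]; rewrite ler_norml; apply/andP; split; lra.
  by rewrite [rho * 4]mulrC lerD2r g_diff.
Qed.

(** Normalize the points of an independent set for the relation of having projections at distance at
    most 1. Since [#|A| ^ 2 <= 8 * #|E| * #|I|], the constant is [8 * 48 ^ 2 = 18432]. *)
Lemma shell_config : (0 < #|A|)%N -> #|C|%:R <= 48 * #|A|%:R :> R ->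
  exists (m : nat) (p : 'I_m -> 'rV[R]_d), [/\ forall i, g (p i) = 1,
    forall i j, i != j -> 1 < g (p i - p j) &
    (2 / Num.sqrt 3) ^+ d <= 18432 * m%:R :> R].
Proof.
move=> A0 CA.
have Arefl : {in A, reflexive near_rel}.
  by move=> x _; rewrite /near_rel subrr g00.
have [I [IA indI cardI]] := independent_set Arefl.
exists #|I|, (fun i => proj (enum_val i)); split.
- move=> i; rewrite /proj.
  have : enum_val i \in A by apply: (fintype.subsetP IA); exact: enum_valP.
  rewrite inE => /andP[h _].
  have h0 : 0 < g (lat (enum_val i)) by exact: lt_trans h.
  by rewrite gZ ?invr_ge0 ?(ltW h0)// mulVf// gt_eqF.
- move=> i j ij; rewrite ltNge; apply: indI; [exact: enum_valP|exact: enum_valP|].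
  by rewrite (inj_eq enum_val_inj).
have s30 : 0 < Num.sqrt 3 :> R by rewrite sqrtr_gt0.
have -> : 2 / Num.sqrt 3 = (Num.sqrt 3 / 2)^-1 :> R by rewrite invf_div.
rewrite exprVn -div1r ler_pdivrMr ?exprn_gt0 ?divr_gt0//.
have A20 : 0 < #|A|%:R ^+ 2 :> R by rewrite exprn_gt0// ltr0n.
rewrite -(ler_pM2l A20) mulr1.
have h1 : #|A|%:R ^+ 2 <= 8 * #|E|%:R * #|I|%:R :> R by rewrite -natrX -!natrM ler_nat.
apply: (le_trans h1).
apply: (@le_trans _ _ (8 * ((Num.sqrt 3 / 2) ^+ d * #|C|%:R ^+ 2) * #|I|%:R)).
  by rewrite ler_wpM2r// ler_pM2l.
have h2 : #|C|%:R ^+ 2 <= (48 * #|A|%:R) ^+ 2 :> R by rewrite lerXn2r ?nnegrE// mulr_ge0.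
apply: (@le_trans _ _ (8 * ((Num.sqrt 3 / 2) ^+ d * (48 * #|A|%:R) ^+ 2) * #|I|%:R)).
  by rewrite ler_wpM2r// ler_pM2l// ler_wpM2l// exprn_ge0// divr_ge0// ltW.
by rewrite le_eqVlt; apply/orP; left; apply/eqP; ring.
Qed.

End Shell.

(** With [q = 2 ^ (1 / d)], dilation by [q] doubles volumes, so the numbers of lattice points with
    [g <= q ^ k * t0] lie between constant multiples of [2 ^ k]. Then [growth_window] finds a shell
    that is a fixed part of the ball two steps larger. *)
Theorem sublinear_config :
  exists (m : nat) (p : 'I_m -> 'rV[R]_d), [/\ forall i, g (p i) = 1,
    forall i j, i != j -> 1 < g (p i - p j) &
    (2 / Num.sqrt 3) ^+ d <= 18432 * m%:R :> R].
Proof.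
pose q : R := 2 `^ (d%:R^-1).
have d0R : d%:R != 0 :> R by rewrite pnatr_eq0 -lt0n.
have qd : q ^+ d = 2 by rewrite -powR_mulrn ?powR_ge0// -powRrM mulVf// powRr1.
have q0 : 0 < q by rewrite powR_gt0.
have q1 : 1 < q.
  rewrite ltNge; apply/negP => q1; have : q ^+ d <= 1 by rewrite exprn_ile1// ltW.
  by rewrite qd; lra.
(* The first term makes [(q - 1)] times any radius exceed the error [4 * rho]; the term 1 keeps
   radii at least 1, which absorbs the [+ 1] in the count of integers of an interval. *)
pose t0 := 4 * rho / (q - 1) + 1.
have q10 : 0 < q - 1 by rewrite subr_gt0.
have t01 : 1 <= t0 by rewrite lerDr divr_ge0 ?mulr_ge0 ?(ltW q10) ?(ltW rho0).
have t00 : 0 < t0 by exact: lt_le_trans t01.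
have qt0 : 4 * rho <= (q - 1) * t0.
  by rewrite /t0 mulrDr mulr1 [(q - 1) * _]mulrC divfK ?gt_eqF// lerDl ltW.
have c10 : 0 < (t0 / rho) ^+ d by rewrite exprn_gt0// divr_gt0.
have [N HN] := growth_window (((2 * S + 1) * t0) ^+ d) c10.
pose T := q ^+ N * t0.
have T0 : 0 < T by rewrite mulr_gt0// exprn_gt0.
have ST0 : 0 <= 2 * (S * T) by apply: mulr_ge0 => //; apply: mulr_ge0; exact: ltW.
have Tr0 : 0 <= T / rho by apply: divr_ge0; exact: ltW.
have [M MT] : exists M : nat, 2 * (S * T) + 2 + T / rho <= M%:R.
  by exists (Num.bound (2 * (S * T) + 2 + T / rho)); rewrite ltW// archi_boundP// !addr_ge0.
pose lat (x : {ffun 'I_d -> 'I_(2 * M).+1}) : 'rV[R]_d := \row_l centered (x l).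
pose B k : {set {ffun 'I_d -> 'I_(2 * M).+1}} := [set x | g (lat x) <= q ^+ k * t0].
have tk k : (k <= N)%N -> q ^+ k * t0 <= T.
  by move=> kN; rewrite ler_pM2r// ler_weXn2l// ltW.
have tk1 k : 1 <= q ^+ k * t0 by rewrite mulr_ege1// exprn_ege1// ltW.
have scale c k : (c * (q ^+ k * t0)) ^+ d = (c * t0) ^+ d * 2 ^+ k.
  by rewrite mulrCA exprMn -exprM mulnC exprM qd mulrC.
have [|k [kN grow slow]] := HN (fun k => #|B k|%:R).
  move=> k kN; have Tk := tk k kN; have tk0 : 0 < q ^+ k * t0 by exact: lt_le_trans (tk1 k).
  apply/andP; split.
    rewrite [t0 / rho]mulrC -scale; apply: card_box_ge.
    - by rewrite mulr_ge0 ?invr_ge0 ?(ltW rho0) ?(ltW tk0).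
    - apply: le_trans MT; rewrite mulrC; apply: (@le_trans _ _ (T / rho)); last by lra.
      by rewrite ler_pM2r ?invr_gt0.
    - move=> x Hx; rewrite inE.
      have -> : q ^+ k * t0 = rho * (rho^-1 * (q ^+ k * t0)) by rewrite mulVKf ?gt_eqF.
      by apply: g_up => l; rewrite mxE.
  rewrite -scale; apply: (@le_trans _ _ ((2 * (S * (q ^+ k * t0)) + 1) ^+ d)).
    apply: card_box_le; first by rewrite mulr_ge0 ?(ltW S0) ?(ltW tk0).
    move=> x; rewrite inE => xB l.
    have := g_low (lat x) l; rewrite mxE => /le_trans; apply.
    by rewrite ler_pM2l.
  have h1 : 0 <= 2 * (S * (q ^+ k * t0)) + 1.
    by rewrite addr_ge0// mulr_ge0// mulr_ge0 ?(ltW S0) ?(ltW tk0).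
  have h2 : 2 * (S * (q ^+ k * t0)) + 1 <= (2 * S + 1) * (q ^+ k * t0).
    have -> : (2 * S + 1) * (q ^+ k * t0) = 2 * (S * (q ^+ k * t0)) + q ^+ k * t0 by ring.
    by rewrite lerD2l.
  by apply: lerXn2r; rewrite ?nnegrE// (le_trans h1).
pose s := q ^+ k * t0.
have s0 : 0 < s by exact: lt_le_trans (tk1 k).
have B3 : q ^+ k.+3 * t0 = q ^+ 3 * s by rewrite /s -addn3 exprD mulrAC mulrC.
have qs : 4 * rho <= (q - 1) * s.
  by rewrite (le_trans qt0)// ler_pM2l// /s ler_peMl ?(ltW t00)// exprn_ege1// ltW.
have sM : 2 * (S * (q ^+ 3 * s)) + 2 <= M%:R.
  apply: le_trans MT; rewrite -B3.
  have : S * (q ^+ k.+3 * t0) <= S * T by rewrite ler_pM2l// tk.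
  by lra.
have AB : [set x | s < g (lat x) <= q * s] = B k.+1 :\: B k.
  by apply/setP => x; rewrite !inE -ltNge exprS -mulrA.
have BB : B k \subset B k.+1.
  apply/fintype.subsetP => x; rewrite !inE => /le_trans; apply.
  by rewrite ler_pM2r// ler_weXn2l// ltW.
have B10 : 0 < #|B k.+1|%:R :> R.
  rewrite ltr0n; apply/card_gt0P; exists [ffun=> inord M]; rewrite inE.
  have -> : lat [ffun=> inord M] = 0.
    apply/rowP => l; rewrite !mxE ffunE /centered inordK; first exact: subrr.
    by rewrite ltnS mul2n -addnn leq_addr.
  by rewrite g00 ltW// (lt_le_trans _ (tk1 _)).
have cardA : #|B k.+1 :\: B k|%:R = #|B k.+1|%:R - #|B k|%:R :> R.
  by rewrite cardsDS// natrB// subset_leq_card.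
apply: (@shell_config M q s q1 s0 qs sM).
- by rewrite AB -(ltr_nat R) cardA; lra.
(* Growth by [3 / 2] leaves at least a third of [B k.+1] in the shell, and [B k.+3] is at most 16
   times [B k.+1], whence [48 = 3 * 16]. *)
- rewrite AB cardA -B3 -/(B k.+3); lra.
Qed.

End Sublinear.

(** * The gauge of a convex body *)

Local Open Scope classical_set_scope.
Local Open Scope ring_scope.

Section Gauge.
Variables (d : nat) (K : set (vec d)).
Hypotheses (d_gt0 : (0 < d)%N) (compactK : compact K) (convexK : convexR K).
Hypothesis intK0 : interior K 0.

Lemma homothetE (v x : vec d) (l : RR) : 0 < l ->
  homothet v l K x <-> K (l^-1 *: (x - v)).
Proof.
move=> l0; split.
  by move=> [y Ky <-]; rewrite addrC addKr scalerA mulVf ?gt_eqF// scale1r.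
move=> Ky; exists (l^-1 *: (x - v)) => //.
by rewrite scalerA divff ?gt_eqF// scale1r addrC subrK.
Qed.

Lemma ball_coord (x y : vec d) (e : RR) : 0 < e ->
  ball x e y <-> forall l, `|x 0 l - y 0 l| < e.
Proof.
move=> e0; split; first by move=> [_ xy] l; exact: xy.
by move=> xy; split=> // i j; rewrite (ord1 i); exact: (xy j).
Qed.

Lemma origin_ball : exists2 r : RR, 0 < r & forall x : vec d, (forall l, `|x 0 l| < r) -> K x.
Proof.
have /nbhs_ballP[r r0 rK] := intK0.
exists r => // x xr; apply: rK; apply/ball_coord => // l.
by rewrite mxE sub0r normrN.
Qed.

Lemma coord_bounded : exists2 S : RR, 0 < S & forall x, K x -> forall l, `|x 0 l| <= S.
Proof.
have [M [_ HM]] := compact_bounded compactK.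
exists (`|M| + 2) => [|x Kx l]; first by rewrite ltr_wpDl.
have xM : `|x| <= `|M| + 1.
  by apply: HM => //; rewrite (le_lt_trans (ler_norm M))// ltrDl.
have : ball (0 : vec d) (`|M| + 2) x.
  rewrite mx_norm_ball /ball_ /= sub0r normrN (le_lt_trans xM)//.
  by rewrite ltrD2l; lra.
by rewrite ball_coord ?ltr_wpDl// => /(_ l); rewrite mxE sub0r normrN => /ltW.
Qed.

Let K0 : K 0. Proof. exact: nbhs_singleton intK0. Qed.

Lemma convex_shrink (x : vec d) (t : RR) : K x -> 0 <= t -> t <= 1 -> K (t *: x).
Proof. by move=> Kx t0 t1; have := convexK Kx K0 t0 t1; rewrite scaler0 addr0. Qed.

Lemma gauge_le (x : vec d) (l : RR) : 0 < l -> K (l^-1 *: x) -> gauge K x <= l.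
Proof.
move=> l0 Kx; apply: ge_inf; first by exists 0 => m [/ltW].
by split => //; apply/homothetE; rewrite ?subr0.
Qed.

Lemma gauge_nonempty (x : vec d) : [set l : RR | 0 < l /\ homothet 0 l K x] !=set0.
Proof.
have [r r0 rK] := origin_ball.
pose n := \sum_l `|x 0 l| + 1.
have n0 : 0 < n by rewrite ltr_wpDl// sumr_ge0.
have nr0 : 0 < n / r by rewrite divr_gt0.
exists (n / r); split => //; apply/homothetE => //; rewrite subr0.
apply: rK => l; rewrite mxE normrM gtr0_norm ?invr_gt0// ltr_pdivrMl//.
rewrite divfK ?gt_eqF// /n (bigD1 l)//= -addrA ltrDl.
by rewrite ltr_wpDl// sumr_ge0.
Qed.

Lemma gauge_lt (x : vec d) (l : RR) : gauge K x < l -> 0 < l /\ K (l^-1 *: x).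
Proof.
move=> /(inf_lt (gauge_nonempty x))[m [m0 /(homothetE _ _ m0)]]; rewrite subr0 => Kx ml.
have l0 := lt_trans m0 ml; split => //.
have -> : l^-1 *: x = (m / l) *: (m^-1 *: x).
  by rewrite scalerA mulrAC divff ?gt_eqF// mul1r.
by apply: convex_shrink => //; [exact/ltW/divr_gt0|rewrite ler_pdivrMr// mul1r ltW].
Qed.

Lemma gauge_ge0 (x : vec d) : 0 <= gauge K x.
Proof. by apply: lb_le_inf (gauge_nonempty x) _ => l [/ltW]. Qed.

(** Lets estimates be made for scales [l] strictly above the gauge, for which [gauge_lt] puts the
    scaled point in [K], without asking whether the infimum is attained. *)
Lemma gauge_le_lt (x : vec d) (b c : RR) : 0 <= c ->
  (forall l, gauge K x < l -> b <= c * l) -> b <= c * gauge K x.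
Proof.
move=> c0 H; apply/ler_addgt0Pr => e e0.
(* The denominator [c + 1] also covers [c = 0]. *)
apply: (@le_trans _ _ (c * (gauge K x + e / (c + 1)))).
  by apply: H; rewrite ltrDl divr_gt0// ltr_wpDl.
rewrite mulrDr lerD2l mulrCA ger_pMr// ler_pdivrMr ?mul1r ?lerDl// ltr_wpDl//.
Qed.

Lemma gauge0 : gauge K 0 = 0.
Proof.
apply/eqP; rewrite eq_le gauge_ge0 andbT; apply/ler_addgt0Pr => e e0.
by rewrite add0r; apply: gauge_le => //; rewrite scaler0.
Qed.

Lemma gaugeZ (c : RR) (x : vec d) : 0 <= c -> gauge K (c *: x) = c * gauge K x.
Proof.
rewrite le_eqVlt => /orP[/eqP <-|]; first by rewrite scale0r mul0r gauge0.
have H (c' : RR) (y : vec d) : 0 < c' -> gauge K (c' *: y) <= c' * gauge K y.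
  move=> c0; apply: gauge_le_lt; first exact: ltW.
  move=> l /gauge_lt[l0 Kl]; apply: gauge_le; first exact: mulr_gt0.
  by rewrite scalerA invfM mulrAC mulVf ?gt_eqF// mul1r.
move=> c0; apply/eqP; rewrite eq_le H//=.
have := H c^-1 (c *: x); rewrite invr_gt0 => /(_ c0).
rewrite scalerA mulVf ?gt_eqF// scale1r => h.
by rewrite -ler_pdivlMl.
Qed.

Lemma gaugeD (x y : vec d) : gauge K (x + y) <= gauge K x + gauge K y.
Proof.
apply/ler_addgt0Pr => e e0.
have e20 : 0 < e / 2 by rewrite divr_gt0.
have /gauge_lt[l0 Kx] : gauge K x < gauge K x + e / 2 by rewrite ltrDl.
have /gauge_lt[m0 Ky] : gauge K y < gauge K y + e / 2 by rewrite ltrDl.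
set l := gauge K x + e / 2 in l0 Kx; set m := gauge K y + e / 2 in m0 Ky.
have -> : gauge K x + gauge K y + e = l + m by rewrite /l /m; field.
have lm0 : 0 < l + m by rewrite addr_gt0.
apply: gauge_le => //.
have -> : (l + m)^-1 *: (x + y) = (l / (l + m)) *: (l^-1 *: x) + (1 - l / (l + m)) *: (m^-1 *: y).
  rewrite scalerDr !scalerA; congr (_ *: _ + _ *: _).
    by field; rewrite !gt_eqF.
  by field; rewrite !gt_eqF.
by apply: convexK => //; rewrite ?divr_ge0 ?(ltW l0) ?(ltW lm0)// ler_pdivrMr// mul1r lerDl ltW.
Qed.

Lemma gauge_upper : exists2 rho : RR, 0 < rho &
  forall (x : vec d) (e : RR), (forall l, `|x 0 l| <= e) -> gauge K x <= rho * e.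
Proof.
have [r r0 rK] := origin_ball.
(* The factor 2 gives the strict inequality that the open ball around the origin demands. *)
exists (2 / r) => [|x e xe]; first by rewrite divr_gt0.
have e0 : 0 <= e by exact: le_trans (xe (Ordinal d_gt0)).
apply/ler_addgt0Pr => a a0.
pose t := e + a * r / 2.
have t0 : 0 < t by rewrite ltr_wpDl// divr_gt0// mulr_gt0.
have -> : 2 / r * e + a = 2 / r * t by rewrite /t; field; rewrite gt_eqF.
have rt0 : 0 < 2 / r * t by rewrite mulr_gt0// divr_gt0.
apply: gauge_le => //; apply: rK => l.
rewrite mxE normrM gtr0_norm ?invr_gt0// ltr_pdivrMl//.
have -> : 2 / r * t * r = 2 * t by field; rewrite gt_eqF.
rewrite (le_lt_trans (xe l))// (@le_lt_trans _ _ t)//; last by lra.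
by rewrite lerDl divr_ge0// mulr_ge0// ltW.
Qed.

Lemma gauge_lower : exists2 S : RR, 0 < S & forall (x : vec d) l, `|x 0 l| <= S * gauge K x.
Proof.
have [S S0 KS] := coord_bounded.
exists S => // x j; apply: gauge_le_lt => [|l /gauge_lt[l0 /KS/(_ j)]]; first exact: ltW.
by rewrite mxE normrM gtr0_norm ?invr_gt0// ler_pdivrMl// mulrC.
Qed.

(** The multiples [t *: p] with [t < 1] belong to [K] and approach [p]. Were [p] interior, some
    multiple with [t > 1] would belong to [K] and the gauge would be below 1. *)
Lemma gauge1_bd (p : vec d) : gauge K p = 1 -> bdK K p.
Proof.
move=> p1; split.
  have [S S0 pS] := gauge_lower.
  have {}pS l : `|p 0 l| <= S by rewrite -[S]mulr1 -p1.
  move=> B /nbhs_ballP[e e0 eB].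
  (* Chosen so that [(1 - t) * S = t * e < e], which bounds the displacement in each coordinate. *)
  pose t := S / (S + e).
  have Se0 : 0 < S + e by rewrite addr_gt0.
  have t0 : 0 < t by rewrite divr_gt0.
  have t1 : t < 1 by rewrite ltr_pdivrMr// mul1r ltrDl.
  exists (t *: p); split.
    have /gauge_lt[_] : gauge K p < t^-1 by rewrite p1 invf_gt1.
    by rewrite invrK.
  apply: eB; apply/ball_coord => // l; rewrite mxE.
  rewrite -{1}[p 0 l]mul1r -mulrBl normrM gtr0_norm ?subr_gt0//.
  apply: (@le_lt_trans _ _ ((1 - t) * S)); first by rewrite ler_wpM2l// subr_ge0 ltW.
  have -> : (1 - t) * S = S / (S + e) * e by rewrite /t; field; rewrite gt_eqF.
  by rewrite -/t gtr_pMl.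
move=> /nbhs_ballP[e e0 eK].
have [S S0 pS] := gauge_lower.
have {}pS l : `|p 0 l| <= S by rewrite -[S]mulr1 -p1.
pose t := 1 + e / (2 * S).
have u0 : 0 < e / (2 * S) by rewrite divr_gt0// mulr_gt0.
have t1 : 1 < t by rewrite ltrDl.
have t0 : 0 < t by exact: lt_trans t1.
have : gauge K p <= t^-1.
  apply: gauge_le; rewrite ?invr_gt0// invrK; apply: eK; apply/ball_coord => // l.
  rewrite mxE -{1}[p 0 l]mul1r -mulrBl normrM /t opprD addNKr normrN (gtr0_norm u0).
  apply: (@le_lt_trans _ _ (e / (2 * S) * S)); first by rewrite ler_wpM2l// ltW.
  have -> : e / (2 * S) * S = e / 2 by field; rewrite gt_eqF.
  by rewrite ltr_pdivrMr// ltr_pMr// ltr1n.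
by rewrite p1 leNgt invf_lt1// t1.
Qed.

End Gauge.

(** For the centers [- p i], membership of one center in another translate means [p j - p i] in [K],
    hence gauge at most 1. The translates meet at 0 because [K], being closed, contains its
    boundary. *)
Lemma h_config_kappa_config (d : nat) (K : set (vec d)) (m : nat) :
  compact K -> h_config K m -> kappa_config K m.
Proof.
move=> cK [p [pbd pdist]].
have closedK : closed K by apply: compact_closed => //; exact: norm_hausdorff.
exists (fun i => - p i), (fun=> 1); split; [by []|split] => i j.
- move=> ij [y Ky]; rewrite scale1r => E.
  have Kd : K (p j - p i).
    by have -> : p j - p i = y by rewrite -E addrA subrr add0r.
  have := pdist j i; rewrite eq_sym => /(_ ij); rewrite ltNge => /negP; apply.
  apply: ge_inf; first by exists 0 => l [/ltW].
  by split => //; exists (p j - p i) => //; rewrite scale1r add0r.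
- have Kp k : K (p k) by apply: closedK; case: (pbd k).
  by exists 0; split; [exists (p i)|exists (p j)] => //; rewrite scale1r addNr.
Qed.

Theorem theorem6 : exists d0 : nat, forall (d : nat), (d0 <= d)%N ->
  forall K : set (vec d), convex_body K -> interior K 0 ->
    (h' K <= kappa' K)%E /\
    ((1 / (4 * (d%:R : RR) ^+ 2) * (2 / Num.sqrt (3 : RR)) ^+ d)%:E <= h' K)%E.
Proof.
(* The least dimension for which [4 * d ^ 2] reaches the constant 18432: [4 * 68 ^ 2 = 18496]. *)
exists 68%N => d d68 K [cK [convK _]] intK; split.
  apply: le_ereal_sup => _ [m hm <-]; exists m => //.
  exact: h_config_kappa_config.
have d_gt0 : (0 < d)%N by exact: leq_trans d68.
have [rho rho0 up] := gauge_upper d_gt0 intK.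
have [S S0 low] := gauge_lower cK convK intK.
have [m [p [p1 pd pm]]] := sublinear_config d_gt0 rho0 S0
  (gaugeZ convK intK) (gaugeD convK intK) up low.
apply: (@le_trans _ _ (m%:R : RR)%:E); last first.
  apply: ereal_sup_ubound; exists m => //; exists p; split => // i.
  exact: (gauge1_bd cK convK intK).
rewrite lee_fin div1r.
have d2 : 18432 <= 4 * (d%:R : RR) ^+ 2.
  have : 68 <= d%:R :> RR by rewrite ler_nat.
  move=> d68R; have : 0 <= (d%:R - 68) * (d%:R + 68) :> RR.
    by rewrite mulr_ge0 ?subr_ge0 ?addr_ge0.
  by lra.
rewrite ler_pdivrMl; last by rewrite mulr_gt0// exprn_gt0// ltr0n.
by rewrite (le_trans pm)// ler_wpM2r.
Qed.
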